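(* Let $\sigma=\begin{pmatrix} m'&m\\ n'&n\end{pmatrix}\in SL_2(\mathbb Z)$ with $n>0$, let $u\in\mathbb C^*$ (with a fixed root $u^{1/n}$), and let $\zeta=e^{2\pi i/n}$ be a primitive $n$th root of unity. There is an action of $\mathfrak{Diff}_q$ on $F^a_\alpha$ in which $c$ acts by $n$, $c'$ by $n'$, $H_k=E_{0,k}$ ($k\neq0$) by $a_{nk}$, and $E_{1,k}$, $E_{-1,k}$ act by the coefficients of $z^{-k}$ in $$E^{tw}(z)=z^{n'/n}\frac{u^{\frac1n}}{n(1-q^{1/n})}\sum_{l=0}^{n-1}\zeta^{ln'}:\exp\Big(\sum_{k\ne0}\frac{q^{-k/2n}-q^{k/2n}}{k}a_k\zeta^{-kl}z^{-k/n}\Big):,$$ $$F^{tw}(z)=z^{-n'/n}\frac{u^{-\frac1n}}{n(1-q^{-1/n})}\sum_{l=0}^{n-1}\zeta^{-ln'}:\exp\Big(\sum_{k\ne0}\frac{q^{k/2n}-q^{-k/2n}}{k}a_k\zeta^{-kl}z^{-k/n}\Big):,$$ respectively. The representation obtained is isomorphic to $\mathcal F_u^\sigma$.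
   Context: $q\in\mathbb C^*$ is not a root of unity; compatible fractional powers of $q$ are fixed. The Lie algebra $\mathfrak{Diff}_q$ has basis $E_{k,l}$ ($(k,l)\in\mathbb Z^2\setminus\{(0,0)\}$), $c$, $c'$, with $c,c'$ central and $[E_{k,l},E_{r,s}]=(q^{(sk-lr)/2}-q^{(lr-sk)/2})E_{k+r,l+s}+\delta_{k,-r}\delta_{l,-s}(c'k+cl)$. It is generated by $c,c'$, $E_{1,k}$, $E_{-1,k}$, $H_k=E_{0,k}$; $E(z)=\sum_kE_{1,k}z^{-k}$, $F(z)=\sum_kE_{-1,k}z^{-k}$. Twists. $\sigma\in SL_2(\mathbb Z)$ acts by the automorphism $\sigma(E_{k,l})=E_{m'k+ml,\,n'k+nl}$, $\sigma(c')=m'c'+n'c$, $\sigma(c)=mc'+nc$. For a module $M$ with action $\rho_M$, $M^\sigma$ is the same space with action $\rho_M\circ\sigma$. $F^a_\alpha$ is the Fock module of the Heisenberg algebra $[a_k,a_l]=k\delta_{k+l,0}$ ($k,l\in\mathbb Z$) generated by $|\alpha\rangle$ with $a_k|\alpha\rangle=0$ for $k>0$, $a_0|\alpha\rangle=\alpha|\alpha\rangle$ (the value of $\alpha\in\mathbb C$ plays no role). Normal ordering $:\exp(\cdot):$ puts the exponential of the modes $a_k$ with $k<0$ to the left of that of the modes with $k>0$. The Fock module $\mathcal F_u$ is $F^a_\alpha$ with $c\mapsto1$, $c'\mapsto0$, $H_k\mapsto a_k$, $E(z)\mapsto\frac{u}{1-q}\exp\big(\sum_{k>0}\frac{q^{-k/2}-q^{k/2}}{k}a_{-k}z^k\big)\exp\big(\sum_{k<0}\frac{q^{-k/2}-q^{k/2}}{k}a_{-k}z^k\big)$,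 $F(z)\mapsto\frac{u^{-1}}{1-q^{-1}}\exp\big(\sum_{k>0}\frac{q^{k/2}-q^{-k/2}}{k}a_{-k}z^k\big)\exp\big(\sum_{k<0}\frac{q^{k/2}-q^{-k/2}}{k}a_{-k}z^k\big)$. *)

(* Defs.v *)
From HB Require Import structures.
From mathcomp Require Import all_boot all_order all_algebra.
From mathcomp Require Import complex.
From mathcomp Require Import all_classical all_reals all_analysis.
From mathcomp Require Import freeg.

Set Implicit Arguments.
Unset Strict Implicit.
Unset Printing Implicit Defensive.

Import Order.TTheory GRing.Theory Num.Theory.
Local Open Scope classical_set_scope.
Local Open Scope ring_scope.

(* A compatible choice of fractional powers of [q]: [qpow r] stands for q^r. *)
Definition fractional_powers (C : fieldType) (q : C) (qpow : rat -> C) : Prop :=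
  qpow 1 = q /\ forall r s, qpow (r + s) = qpow r * qpow s.

Definition not_root_of_unity (C : fieldType) (q : C) : Prop :=
  forall k : nat, (0 < k)%N -> q ^+ k != 1.

(* exp (2 pi i / n) *)
Definition zeta (R : realType) (n : nat) : R[i] :=
  Complex (cos (2 * pi / n%:R)) (sin (2 * pi / n%:R)).

(* Index set of the basis of Diff_q. *)
Inductive diffq_index :=
  | iE of {p : int * int | p != (0, 0)}
  | ic
  | ic'.

Definition diffq_index_code (i : diffq_index) :
    {p : int * int | p != (0, 0)} + bool :=
  match i with iE p => inl p | ic => inr true | ic' => inr false end.

Definition diffq_index_decode (s : {p : int * int | p != (0, 0)} + bool) :
    diffq_index :=
  match s with inl p => iE p | inr true => ic | inr false => ic' end.

Lemma diffq_index_codeK : cancel diffq_index_code diffq_index_decode.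
Proof. by case. Qed.

HB.instance Definition _ :=
  Choice.copy diffq_index (can_type diffq_index_codeK).

Section Diffq.
Variable C : fieldType.

(* Formal linear combinations of indices; [fglift f] is the linear extension
   of a function [f] of the indices. *)
Definition diffq : lmodType C := {freeg diffq_index / C}.

Definition basis (i : diffq_index) : diffq := << i >>.

(* E_{0,0} is not an element of the algebra; [dE 0 0] is set to 0, which is
   harmless because the structure constant in front of it is always 0. *)
Definition dE (k l : int) : diffq :=
  if insub (k, l) is Some p then basis (iE p) else 0.
Definition dc : diffq := basis ic.
Definition dc' : diffq := basis ic'.

Definition bracket_index (qpow : rat -> C) (i j : diffq_index) : diffq :=
  match i, j with
  | iE p, iE p' =>
      let: (k, l) := \val p in
      let: (r, s) := \val p' in
      (qpow ((s * k - l * r)%:~R / 2) - qpow ((l * r - s * k)%:~R / 2))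
        *: dE (k + r) (l + s)
      + ((k == - r) && (l == - s))%:R *: (k%:~R *: dc' + l%:~R *: dc)
  | _, _ => 0
  end.

Definition bracket (qpow : rat -> C) (x y : diffq) : diffq :=
  fglift (fun i => fglift (bracket_index qpow i) y) x.

(* With sigma = [m', m; n', n] (row by row). *)
Definition sigma_index (sigma : 'M[int]_2) (i : diffq_index) : diffq :=
  let m' := sigma 0 0 in let m := sigma 0 1 in
  let n' := sigma 1 0 in let n := sigma 1 1 in
  match i with
  | iE p => let: (k, l) := \val p in dE (m' * k + m * l) (n' * k + n * l)
  | ic => m%:~R *: dc' + n%:~R *: dc
  | ic' => m'%:~R *: dc' + n'%:~R *: dc
  end.

Definition sigma_aut (sigma : 'M[int]_2) : diffq -> diffq :=
  fglift (sigma_index sigma).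

Lemma fglift_basis (W : lmodType C) (f : diffq_index -> W) (i : diffq_index) :
  fglift f (basis i) = f i.
Proof. by rewrite /basis liftU scale1r. Qed.

Lemma bracketE (qpow : rat -> C) (k l r s : int) :
  (k, l) != (0, 0) -> (r, s) != (0, 0) ->
  bracket qpow (dE k l) (dE r s) =
    (qpow ((s * k - l * r)%:~R / 2) - qpow ((l * r - s * k)%:~R / 2))
      *: dE (k + r) (l + s)
    + ((k == - r) && (l == - s))%:R *: (k%:~R *: dc' + l%:~R *: dc).
Proof.
move=> nz nz'; rewrite {1 2}/dE !insubT /bracket !fglift_basis /=.
by rewrite -/(dE _ _).
Qed.

Definition is_diffq_action (qpow : rat -> C) (V : lmodType C)
    (rho : diffq -> V -> V) : Prop :=
  [/\ forall v, linear (fun x => rho x v),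
      forall x, linear (rho x)
    & forall x y v,
        rho (bracket qpow x y) v = rho x (rho y v) - rho y (rho x v)].

Definition twist (sigma : 'M[int]_2) (V : lmodType C) (rho : diffq -> V -> V) :
    diffq -> V -> V :=
  fun x => rho (sigma_aut sigma x).

Definition isomorphic (V W : lmodType C)
    (rho : diffq -> V -> V) (rho' : diffq -> W -> W) : Prop :=
  exists f : V -> W,
    [/\ linear f, bijective f & forall x v, f (rho x v) = rho' x (f v)].

End Diffq.

Section Fock.
Variables (C : numFieldType) (V : lmodType C).

(* [V] with the operators [a k] is the Fock module with highest weight vector
   [vac] = |alpha>.  Highest weight modules of level 1 over the Heisenberg
   algebra are irreducible in characteristic 0, so a nonzero module generated
   by such a vector is automatically the universal one. *)
Definition is_heisenberg_fock (a : int -> V -> V) (alpha : C) (vac : V) : Prop :=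
  [/\ (forall k, linear (a k)) /\
      (forall k l v,
         a k (a l v) - a l (a k v) = (if k + l == 0 then k%:~R else 0) *: v),
      vac != 0,
      forall k, 0 < k -> a k vac = 0,
      a 0 vac = alpha *: vac
    & forall P : V -> Prop,
        P vac ->
        (forall (x : C) v w, P v -> P w -> P (x *: v + w)) ->
        (forall k v, P v -> P (a k v)) ->
        forall v, P v].

(* Formal power series in one variable with coefficients in operators on [V]:
   [X p] is the coefficient of the p-th power of the variable. *)
Definition opseries := nat -> V -> V.

Definition opseries_one : opseries := fun p v => if p == 0%N then v else 0.

Definition opseries_mul (X Y : opseries) : opseries :=
  fun p v => \sum_(i < p.+1) X i (Y (p - i)%N v).

Definition opseries_exp_coef (X : opseries) (j : nat) : opseries :=
  fun p v => (j`!%:R)^-1 *: iter j (opseries_mul X) opseries_one p v.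

(* exp X for X without constant term, so that X^j does not contribute to the
   coefficient p when j > p. *)
Definition opseries_exp (X : opseries) : opseries :=
  fun p v => \sum_(j < p.+1) opseries_exp_coef X j p v.

(* [vertex a f N] is the coefficient of w^{-N} in
     :exp (sum_{k <> 0} f k a_k w^{-k}):
   that is, the sum over r - p = N of (coefficient of w^p in the exponential of
   the modes k < 0) o (coefficient of w^{-r} in the exponential of the modes
   k > 0).  On every vector of a Fock module only finitely many terms of the
   sum are nonzero, so that the finitely supported sum below has its intended
   value. *)
Definition creation (a : int -> V -> V) (f : int -> C) : opseries :=
  opseries_exp (fun p v => if p == 0%N then 0 else f (- p%:Z) *: a (- p%:Z) v).

Definition annihilation (a : int -> V -> V) (f : int -> C) : opseries :=
  opseries_exp (fun r v => if r == 0%N then 0 else f r%:Z *: a r%:Z v).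

Definition vertex (a : int -> V -> V) (f : int -> C) (N : int) (v : V) : V :=
  \sum_(pr \in [set pr : nat * nat | pr.2%:Z - pr.1%:Z = N])
     creation a f pr.1 (annihilation a f pr.2 v).

(* If X N is the coefficient of w^{-N} in X(w), this is the coefficient of
   z^{-k} in z^{s/n} X(z^{1/n}), as s/n - N/n = -k iff N = n k + s. *)
Definition zcoef (n : nat) (s : int) (X : int -> V -> V) (k : int) : V -> V :=
  X (n%:Z * k + s).

End Fock.

(* (q^{-k/2n} - q^{k/2n}) / k *)
Definition Ecoef (C : fieldType) (qpow : rat -> C) (n : nat) (k : int) : C :=
  (qpow (- k%:~R / (2 * n%:R)) - qpow (k%:~R / (2 * n%:R))) / k%:~R.

(* (q^{k/2n} - q^{-k/2n}) / k *)
Definition Fcoef (C : fieldType) (qpow : rat -> C) (n : nat) (k : int) : C :=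
  (qpow (k%:~R / (2 * n%:R)) - qpow (- k%:~R / (2 * n%:R))) / k%:~R.

(* The Fock module F_u.  The defining exponents are written there as sums of
   g k a_{-k} z^k, i.e. as sums of g (- k) a_k z^{-k}.  The algebra being
   generated by c, c', E_{0,k}, E_{1,k} and E_{-1,k}, at most one action [rho]
   satisfies this. *)
Definition is_fock_module (C : numFieldType) (q : C) (qpow : rat -> C)
    (V : lmodType C) (a : int -> V -> V) (u : C)
    (rho : diffq C -> V -> V) : Prop :=
  [/\ is_diffq_action qpow rho,
      (forall v, rho (dc C) v = v) /\ (forall v, rho (dc' C) v = 0),
      forall k v, k != 0 -> rho (dE C 0 k) v = a k v,
      forall k v, rho (dE C 1 k) v =
        (u / (1 - q)) *: vertex a (fun j => Ecoef qpow 1 (- j)) k v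
    & forall k v, rho (dE C (- 1) k) v =
        (u^-1 / (1 - q^-1)) *: vertex a (fun j => Fcoef qpow 1 (- j)) k v].

Section Twisted.
Variables (R : realType) (qpow : rat -> R[i]).
Variables (V : lmodType R[i]) (a : int -> V -> V).

(* [ur] is the chosen n-th root of u. *)
Definition Etw (n : nat) (n' : int) (ur : R[i]) (k : int) (v : V) : V :=
  (ur / (n%:R * (1 - qpow (1 / n%:R)))) *:
    \sum_(l < n) zeta R n ^ (l%:Z * n') *:
      zcoef n n'
        (vertex a (fun j => Ecoef qpow n j * zeta R n ^ (- (j * l%:Z)))) k v.

Definition Ftw (n : nat) (n' : int) (ur : R[i]) (k : int) (v : V) : V :=
  (ur^-1 / (n%:R * (1 - qpow (- (1 / n%:R))))) *:
    \sum_(l < n) zeta R n ^ (- (l%:Z * n')) *: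
      zcoef n (- n')
        (vertex a (fun j => Fcoef qpow n j * zeta R n ^ (- (j * l%:Z)))) k v.

Definition is_twisted_module (n : nat) (n' : int) (ur : R[i])
    (rho : diffq R[i] -> V -> V) : Prop :=
  [/\ is_diffq_action qpow rho,
      (forall v, rho (dc R[i]) v = n%:R *: v) /\
      (forall v, rho (dc' R[i]) v = n'%:~R *: v),
      forall k v, k != 0 -> rho (dE R[i] 0 k) v = a (n%:Z * k) v,
      forall k v, rho (dE R[i] 1 k) v = Etw n n' ur k v
    & forall k v, rho (dE R[i] (- 1) k) v = Ftw n n' ur k v].

End Twisted.

(* Main.v *)
(* Put y = q^{1/2n}. The sum over the n-th roots of unity in E^tw keeps exactly
   the powers w^{-(n k + n')} of w = z^{1/n}, so E_{k,l} acts in the twisted module as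
   E_{k, n l + n' k} acts in the Fock module of Diff_{q^{1/n}} with parameter
   u^{1/n}, and the existence of the action reduces to that of Fock modules.

   In a Fock module E_{k,l} is the coefficient X_{k,l} of z^{-l} in
   u^k / (1 - y^{2k}) :exp (sum_j (y^{-kj} - y^{kj}) / j a_j z^{-j}): (here with
   q = y^2). A family of operators whose commutators with the modes a_j are
   linear combinations of members of the family vanishes as soon as its vacuum
   expectation values do. This reduces the bracket relations to the values
   <X_{k,l} X_{r,-l}>, the Taylor coefficients of a rational function.

   For the isomorphism with the module twisted by sigma, both modules have
   vacuum vectors which are highest weight vectors for the degree n l + n' k, of
   the same weight, and both are irreducible. For the twisted module this holds
   because X_{k,l} v is a Laurent polynomial in y^k divided by 1 - y^{2k}, so that
   the X_{k,l} with k in an arithmetic progression determine, by interpolation,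
   the derivative at k = 0, which is proportional to a_l v. Hence the submodule
   of the direct sum generated by the pair of vacuum vectors is the graph of an
   isomorphism. *)
Require Import Defs.
From mathcomp Require Import all_boot all_order all_algebra.
From mathcomp Require Import complex.
From mathcomp Require Import all_classical all_reals all_analysis.
From mathcomp Require Import freeg zify ring.
Import Order.TTheory GRing.Theory Num.Theory.
Local Open Scope ring_scope.

Set Implicit Arguments.
Unset Strict Implicit.
Unset Printing Implicit Defensive.

(** * The Fock space *)

Section LinearFacts.
Variables (K : pzRingType) (U W : lmodType K) (f : U -> W).
Hypothesis fL : linear f.

Lemma linD u v : f (u + v) = f u + f v.
Proof. by rewrite -[u in LHS]scale1r fL scale1r. Qed.

Lemma lin0 : f 0 = 0.
Proof. by apply: (@addrI _ (f 0)); rewrite -linD !addr0. Qed.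

Lemma linZ c v : f (c *: v) = c *: f v.
Proof. by rewrite -[c *: v]addr0 fL lin0 addr0. Qed.

Lemma linN v : f (- v) = - f v.
Proof. by rewrite -scaleN1r linZ scaleN1r. Qed.

Lemma linB u v : f (u - v) = f u - f v.
Proof. by rewrite linD linN. Qed.

Lemma lin_sum (I : Type) (r : seq I) (P : pred I) (F : I -> U) :
  f (\sum_(i <- r | P i) F i) = \sum_(i <- r | P i) f (F i).
Proof.
elim: r => [|i r IHr]; first by rewrite !big_nil lin0.
by rewrite !big_cons; case: ifP => // _; rewrite linD IHr.
Qed.

End LinearFacts.

Section LinearFunctions.
Variables (K : comPzRingType) (U V W : lmodType K).

Lemma linear_fun_comp (f : V -> W) (g : U -> V) :
  linear f -> linear g -> linear (fun v => f (g v)).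
Proof. by move=> fL gL x v w; rewrite gL fL. Qed.

Lemma linear_fun_add (f g : U -> W) :
  linear f -> linear g -> linear (fun v => f v + g v).
Proof. by move=> fL gL x v w; rewrite fL gL scalerDr addrACA. Qed.

Lemma linear_fun_scale (x : K) (f : U -> W) :
  linear f -> linear (fun v => x *: f v).
Proof. by move=> fL z v w; rewrite fL scalerDr !scalerA mulrC. Qed.

Lemma linear_fun_sub (f g : U -> W) :
  linear f -> linear g -> linear (fun v => f v - g v).
Proof.
by move=> fL gL x v w; rewrite fL gL opprD scalerBr addrACA.
Qed.

End LinearFunctions.

Section Fock.
Variables (C : numFieldType) (V : lmodType C) (a : int -> V -> V).
Variables (alpha : C) (vac : V).
Hypothesis fockV : is_heisenberg_fock a alpha vac.

Lemma fock_linear k : linear (a k).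
Proof. by case: fockV => -[]. Qed.

Lemma fock_comm k l v :
  a k (a l v) = a l (a k v) + (if k + l == 0 then k%:~R else 0) *: v.
Proof. by case: fockV => -[_ <- *]; rewrite addrC subrK. Qed.

Lemma fock_commC k l v : k + l != 0 -> a k (a l v) = a l (a k v).
Proof. by move=> /negPf kl; rewrite fock_comm kl scale0r addr0. Qed.

Lemma fock_vac_gt0 k : 0 < k -> a k vac = 0.
Proof. by case: fockV => _ _ + _ _; apply. Qed.

Lemma fock_vac0 : a 0 vac = alpha *: vac.
Proof. by case: fockV. Qed.

Lemma fock_vac_neq0 : vac != 0.
Proof. by case: fockV. Qed.

Lemma fock_ind (P : V -> Prop) : P vac ->
    (forall (x : C) v w, P v -> P w -> P (x *: v + w)) ->
    (forall k v, P v -> P (a k v)) ->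
  forall v, P v.
Proof. by case: fockV => _ _ _ _; apply. Qed.

(* [a 0] acts as the scalar [alpha], and the annihilation modes can be
   commuted to the right until they reach [vac]. *)
Lemma fock_creation_ind (P : V -> Prop) : P vac ->
    (forall (x : C) v w, P v -> P w -> P (x *: v + w)) ->
    (forall k v, k < 0 -> P v -> P (a k v)) ->
  forall v, P v.
Proof.
move=> Pvac Plin Pa.
(* [S] is the smallest subspace containing [vac] and stable under the creation modes, defined
   impredicatively. It remains to see that all modes preserve it. *)
pose S v := forall T : V -> Prop, T vac ->
  (forall (x : C) v w, T v -> T w -> T (x *: v + w)) ->
  (forall k v, k < 0 -> T v -> T (a k v)) -> T v.
suff SV v : S v by move=> v; apply: (SV v).
have Svac : S vac by [].
have Slin x u w : S u -> S w -> S (x *: u + w).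
  by move=> Su Sw T T1 T2 T3; apply: (T2); [apply: Su|apply: Sw].
have Sneg k u : k < 0 -> S u -> S (a k u).
  by move=> k0 Su T T1 T2 T3; apply: (T3) => //; apply: Su.
have S0 : S 0 by rewrite -(subrr vac) addrC -scaleN1r; apply: Slin.
have SZ x u : S u -> S (x *: u).
  by move=> Su; rewrite -[_ *: _]addr0; apply: Slin.
elim/fock_ind: v => [|x v w|k v Sv]; first by [].
  exact: Slin.
have [k0|k0] := ltP k 0; first exact: Sneg.
(* Membership of the vector itself is carried along, because commuting [a k] past a creation mode
   leaves a multiple of that vector. *)
suff: S v /\ S (a k v) by case.
apply: (Sv (fun v => S v /\ S (a k v))) => [|x u w [Su Sku] [Sw Skw]|l u l0 [Su Sku]].
- split=> //; move: k0; rewrite le0r => /orP[/eqP->|/fock_vac_gt0->//].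
  by rewrite fock_vac0; apply: SZ.
- by split; [apply: Slin|rewrite fock_linear; apply: Slin].
- split; first exact: Sneg.
  by rewrite fock_comm addrC; apply: Slin => //; apply: Sneg.
Qed.

(** [a l] fails to commute only with [a (- l)], so a bound that is at least |l| survives the
    application of [a l]. This makes the sum in [energy] finite. *)
Lemma fock_locally_nilpotent v :
  exists B : nat, forall k : nat, (B <= k)%N -> a k.+1%:Z v = 0.
Proof.
elim/fock_ind: v => [|x v w [B HB] [B' HB']|l v [B HB]].
- by exists 0%N => k _; rewrite fock_vac_gt0.
- exists (maxn B B') => k; rewrite geq_max => /andP[Bk B'k].
  by rewrite fock_linear HB // HB' // scaler0 addr0.
- exists (maxn B `|l|%N) => k; rewrite geq_max => /andP[Bk lk].
  by rewrite fock_commC ?HB ?(lin0 (fock_linear l)) //; lia.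
Qed.

Definition fock_bound (v : V) : nat := sval (cid (fock_locally_nilpotent v)).

Lemma fock_boundP v (k : nat) : (fock_bound v <= k)%N -> a k.+1%:Z v = 0.
Proof. exact: (svalP (cid (fock_locally_nilpotent v))). Qed.

(** The degree operator $\sum_{j>0}a_{-j}a_j$, Sugawara's $L_0$ without its $a_0^2/2$ term. The sum
    is cut at a bound beyond which its terms vanish on [v]; [energyE] permits any other such
    bound. *)
Definition energy (v : V) : V :=
  \sum_(j < fock_bound v) a (- j.+1%:Z) (a j.+1%:Z v).

Lemma energyE (B : nat) v : (forall k : nat, (B <= k)%N -> a k.+1%:Z v = 0) ->
  energy v = \sum_(j < B) a (- j.+1%:Z) (a j.+1%:Z v).
Proof.
move=> HB; rewrite /energy.
have E (B1 B2 : nat) : (B1 <= B2)%N ->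
    (forall k : nat, (B1 <= k)%N -> a k.+1%:Z v = 0) ->
    \sum_(j < B1) a (- j.+1%:Z) (a j.+1%:Z v) =
    \sum_(j < B2) a (- j.+1%:Z) (a j.+1%:Z v).
  move=> /subnKC <- HB1; rewrite big_split_ord /= [X in _ = _ + X]big1 ?addr0 //.
  by move=> i _; rewrite HB1 ?leq_addr // (lin0 (fock_linear _)).
by rewrite (E _ _ (leq_maxl _ B) (@fock_boundP v)) (E _ _ (leq_maxr (fock_bound v) _) HB).
Qed.

Lemma energy_linear : linear energy.
Proof.
move=> x v w; set B := maxn (fock_bound v) (fock_bound w).
have Bv (k : nat) : (B <= k)%N -> a k.+1%:Z v = 0.
  by rewrite geq_max => /andP[vk _]; apply: fock_boundP.
have Bw (k : nat) : (B <= k)%N -> a k.+1%:Z w = 0.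
  by rewrite geq_max => /andP[_ wk]; apply: fock_boundP.
rewrite (energyE Bv) (energyE Bw) (@energyE B); last first.
  by move=> k Bk; rewrite fock_linear Bv // Bw // scaler0 addr0.
rewrite scaler_sumr -big_split; apply: eq_bigr => j _ /=.
by rewrite !fock_linear.
Qed.

Lemma energy_vac : energy vac = 0.
Proof. by rewrite (@energyE 0) ?big_ord0 // => k _; rewrite fock_vac_gt0. Qed.

(** Only the summand with [j.+1] equal to |k| fails to commute with [a k]. *)
Lemma energy_mode k v : energy (a k v) = a k (energy v) - k%:~R *: a k v.
Proof.
set B := maxn (fock_bound v) (maxn (fock_bound (a k v)) `|k|%N).
have Bv (j : nat) : (B <= j)%N -> a j.+1%:Z v = 0.
  by move=> Bj; apply: fock_boundP; lia.
have Bk (j : nat) : (B <= j)%N -> a j.+1%:Z (a k v) = 0.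
  by move=> Bj; apply: fock_boundP; lia.
rewrite (energyE Bv) (energyE Bk) (lin_sum (fock_linear k)).
have E (j : nat) : a (- j.+1%:Z) (a j.+1%:Z (a k v)) =
   a k (a (- j.+1%:Z) (a j.+1%:Z v))
   - (if `|k|%N == j.+1 then k%:~R else 0) *: a k v.
  rewrite (fock_comm j.+1) (linD (fock_linear _)) (linZ (fock_linear _)).
  rewrite (fock_comm (- _) k) -addrA; congr (_ + _).
  case: ifP => [/eqP k1|k1]; case: ifP => [/eqP k2|k2]; case: ifP => [/eqP k3|k3];
    try lia; rewrite ?scale0r ?addr0 ?add0r ?oppr0 //.
  - have -> : k = j.+1%:Z by lia.
    by rewrite mulrNz scaleNr.
  - have -> : k = - j.+1%:Z by lia.
    by rewrite mulrNz scaleNr opprK.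
under eq_bigr do rewrite E.
rewrite sumrB; congr (_ - _).
rewrite -scaler_suml; congr (_ *: _).
case: (eqVneq k 0) => [->|k0].
  by rewrite big1 // => i _; case: ifP.
have kB : (`|k|.-1 < B)%N by lia.
rewrite (bigD1 (Ordinal kB)) //= ifT; last by lia.
rewrite big1 ?addr0 // => i /eqP ik; rewrite ifF //.
by apply/negbTE/eqP => ki; apply: ik; apply/val_inj => /=; lia.
Qed.

End Fock.

(** * The vacuum expectation value *)

Section VacuumFunctional.
Variables (C : numFieldType) (V : lmodType C) (a : int -> V -> V).
Variables (alpha : C) (vac : V).
Hypothesis fockV : is_heisenberg_fock a alpha vac.

Let aL := fock_linear fockV.
Let nrg := energy fockV.
Let nrgL : linear nrg := energy_linear fockV.

Definition excited (s : seq (nat * V)) :=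
  {in s, forall p, (0 < p.1)%N /\ nrg p.2 = p.1%:R *: p.2}.

Lemma excited_cat s t : excited s -> excited t -> excited (s ++ t).
Proof. by move=> es et p; rewrite mem_cat => /orP[/es|/et]. Qed.

Lemma excited_scale (x : nat -> C) s :
  excited s -> excited [seq (p.1, x p.1 *: p.2) | p <- s].
Proof.
move=> es _ /mapP[p /es[p0 Ep] ->] /=; split=> //.
by rewrite (linZ nrgL) Ep !scalerA mulrC.
Qed.

(* Applying [energy - d] for all the energies [d] occurring in [s] kills the
   right-hand side and multiplies [u] by a nonzero scalar. *)
Lemma ground_excited u s : nrg u = 0 -> excited s ->
  u = \sum_(p <- s) p.2 -> u = 0.
Proof.
move=> Lu es uE.
(* Coefficients depending on the eigenvalue alone are allowed, since [energy - d] rescales a term of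
   energy [e] by [e - d] and the induction must apply to the result. *)
suff H (x : nat -> C) : u = \sum_(p <- s) x p.1 *: p.2 -> u = 0.
  by apply: (H (fun=> 1)); rewrite uE; apply: eq_bigr => p _; rewrite scale1r.
elim: s es u x Lu {uE} => [|[d w] s IHs] es u x Lu.
  by rewrite big_nil.
have [/= d0 Lw] := es _ (mem_head _ _).
rewrite big_cons /= => uE.
have es' : excited s by move=> p ps; apply: es; rewrite in_cons ps orbT.
suff /eqP : - d%:R *: u = 0.
  by rewrite scaler_eq0 oppr_eq0 pnatr_eq0 -[d == 0%N]negbK -lt0n d0 /= => /eqP.
apply: (IHs es' _ (fun e => x e * (e%:R - d%:R))).
  by rewrite (linZ nrgL) Lu scaler0.
have <- : nrg u - d%:R *: u = - d%:R *: u by rewrite Lu add0r scaleNr.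
rewrite uE (linD nrgL) (linZ nrgL) Lw [X in _ - X]scalerDr opprD addrACA.
rewrite !scalerA [d%:R * _]mulrC subrr add0r.
rewrite (lin_sum nrgL) scaler_sumr -sumrB big_seq [RHS]big_seq.
apply: eq_bigr => p /es'[_ Ep]; rewrite (linZ nrgL) Ep !scalerA -scalerBl.
by rewrite mulrBr [d%:R * _]mulrC.
Qed.

(** The mode [a k] with [k < 0] raises the energy by [- k], so it turns the [vac] component into an
    excited vector and keeps the others excited. *)
Lemma fock_split v :
  exists c, exists2 s, excited s & v = c *: vac + \sum_(p <- s) p.2.
Proof.
elim/(fock_creation_ind fockV): v => [|x v w [c [s es ->]] [d [t et ->]]|
    k v k0 [c [s es ->]]].
- by exists 1, [::] => //; rewrite big_nil scale1r addr0.
- exists (x * c + d), ([seq (p.1, x *: p.2) | p <- s] ++ t).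
    apply: excited_cat => //.
    exact: (excited_scale (x := fun=> x) es).
  rewrite big_cat big_map /= -scaler_sumr scalerDr scalerA scalerDl.
  by rewrite addrACA.
- exists 0, ((`|k|%N, c *: a k vac) :: [seq (p.1 + `|k|, a k p.2)%N | p <- s]).
    move=> p; rewrite in_cons => /orP[/eqP->/=|/mapP[r /es[r0 Er] -> /=]].
      split; first by lia.
      rewrite (linZ nrgL) /nrg energy_mode energy_vac (lin0 (aL k)) sub0r.
      rewrite -scaleNr -mulrNz !scalerA mulrC -[- k]gtz0_abs ?oppr_gt0 //.
      by rewrite abszN.
    split; first by lia.
    rewrite /nrg energy_mode -/nrg Er (linZ (aL k)) -scalerBl natrD.
    by rewrite -[in - _](opprK k) mulrNz opprK -[- k]gtz0_abs ?oppr_gt0 ?abszN.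
  rewrite scale0r add0r big_cons big_map /= (linD (aL k)) (linZ (aL k)).
  by rewrite (lin_sum (aL k)).
Qed.

(** The coordinate along [vac], taken from a decomposition picked by choice. By [vevE] it does not
    depend on the pick: a vector of energy 0 that is a sum of vectors of positive energy is zero. *)
Definition vev (v : V) : C := sval (cid (fock_split v)).

Lemma vev_splitP v : exists2 s, excited s & v = vev v *: vac + \sum_(p <- s) p.2.
Proof. exact: (svalP (cid (fock_split v))). Qed.

Lemma vevE c s : excited s -> vev (c *: vac + \sum_(p <- s) p.2) = c.
Proof.
move=> es; set v := _ + _; have [t et vE] := vev_splitP v.
apply/eqP; rewrite -subr_eq0; apply/eqP.
have /eqP : (vev v - c) *: vac = 0.
  apply: (@ground_excited _ (s ++ [seq (p.1, - 1 *: p.2) | p <- t])).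
  - by rewrite (linZ nrgL) /nrg energy_vac scaler0.
  - by apply: excited_cat => //; exact: (excited_scale (x := fun=> - 1) et).
  - rewrite big_cat big_map /= -scaler_sumr scaleN1r scalerBl.
    by apply/eqP; rewrite subr_eq addrAC eq_sym subr_eq -vE addrC.
by rewrite scaler_eq0 (negPf (fock_vac_neq0 fockV)) orbF => /eqP.
Qed.

Lemma vev_vac : vev vac = 1.
Proof.
by have := @vevE 1 [::]; rewrite big_nil scale1r addr0; apply.
Qed.

Lemma vev_linear (x : C) v w : vev (x *: v + w) = x * vev v + vev w.
Proof.
have [s es vE] := vev_splitP v; have [t et wE] := vev_splitP w.
rewrite {1}vE {1}wE -(@vevE (x * vev v + vev w)
  ([seq (p.1, x *: p.2) | p <- s] ++ t)).
  by congr vev; rewrite big_cat big_map /= -scaler_sumr scalerDr scalerA scalerDl addrACA.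
by apply: excited_cat => //; exact: (excited_scale (x := fun=> x) es).
Qed.

Lemma vev0 : vev 0 = 0.
Proof. by have := @vevE 0 [::]; rewrite big_nil scale0r addr0; apply. Qed.

Lemma vevD v w : vev (v + w) = vev v + vev w.
Proof. by rewrite -[v in LHS]scale1r vev_linear mul1r. Qed.

Lemma vevZ x v : vev (x *: v) = x * vev v.
Proof. by rewrite -[x *: v]addr0 vev_linear vev0 addr0. Qed.

Lemma vevB v w : vev (v - w) = vev v - vev w.
Proof. by rewrite vevD -scaleN1r vevZ mulN1r. Qed.

Lemma vev_sum (I : Type) (r : seq I) (F : I -> V) :
  vev (\sum_(i <- r) F i) = \sum_(i <- r) vev (F i).
Proof. by elim/big_ind2: _ => // [|? ? ? ? <- <-]; rewrite ?vev0 ?vevD. Qed.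

Lemma vev_energy v : vev (nrg v) = 0.
Proof.
have [s es ->] := vev_splitP v.
rewrite (linD nrgL) (linZ nrgL) {1}/nrg energy_vac scaler0 (lin_sum nrgL).
rewrite -(@vevE 0 [seq (p.1, p.1%:R *: p.2) | p <- s]).
  rewrite big_map scale0r big_seq [in RHS]big_seq; congr (vev (_ + _)).
  by apply: eq_bigr => p /es[].
exact: (excited_scale (x := fun e => e%:R) es).
Qed.

(** From a vector of energy [d] the mode produces one of energy [d - k], which is positive, while
    the functional kills the image of the energy operator. *)
Lemma vev_creation k v : k < 0 -> vev (a k v) = 0.
Proof.
move=> k0;
have eigen0 d w : nrg w = d%:R *: w -> vev (a k w) = 0.
  move=> Lw; have := vev_energy (a k w).
  rewrite /nrg energy_mode -/nrg Lw (linZ (aL k)) -scalerBl vevZ => /eqP.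
  rewrite mulf_eq0 => /orP[|/eqP//]; rewrite subr_eq0 => /eqP dk.
  have : (k%:~R : C) < 0 by rewrite ltrz0.
  by rewrite -dk ltrn0.
have [s es ->] := vev_splitP v.
rewrite (linD (aL k)) (linZ (aL k)) (lin_sum (aL k)) vevD vevZ vev_sum.
rewrite (@eigen0 0%N vac) ?mulr0 ?add0r; last first.
  by rewrite scale0r /nrg energy_vac.
by rewrite big_seq big1 // => p /es[_ /eigen0].
Qed.

Lemma energy_eq0 v : nrg v = 0 -> v = vev v *: vac.
Proof.
move=> Lv; have [s es vE] := vev_splitP v; apply/eqP; rewrite -subr_eq0.
apply/eqP/(@ground_excited _ s) => //.
  by rewrite (linB nrgL) (linZ nrgL) Lv {1}/nrg energy_vac scaler0 subr0.
by apply/eqP; rewrite subr_eq addrC -vE.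
Qed.

(** The length [d] of products of annihilation modes that kill [v] is the induction parameter in
    [fock_nondegenerate]. *)
Fixpoint killed (d : nat) (v : V) : Prop :=
  if d is d'.+1 then forall j : int, 0 < j -> killed d' (a j v) else v = 0.

Lemma killed_linear d (x : C) v w :
  killed d v -> killed d w -> killed d (x *: v + w).
Proof.
elim: d v w => [|d IHd] v w /= dv dw; first by rewrite dv dw scaler0 addr0.
by move=> j j0; rewrite aL; apply: IHd; [apply: dv|apply: dw].
Qed.

Lemma killed_leq d e v : (d <= e)%N -> killed d v -> killed e v.
Proof.
elim: d e v => [|d IHd] [|e] v //= de dv.
  move=> j j0; rewrite dv (lin0 (aL j)).
  elim: e {de} => [|e IHe] //= i i0; rewrite (lin0 (aL i)); exact: IHe.
by move=> j j0; apply: (IHd) (dv _ j0).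
Qed.

Lemma killed_mode d k v : killed d v -> killed d.+1 (a k v).
Proof.
elim: d v => [|d IHd] v dv j j0.
  by rewrite dv !(lin0 (aL _)).
rewrite (fock_comm fockV) addrC; apply: (killed_linear _ dv).
exact/IHd/dv.
Qed.

Lemma killedP v : exists d, killed d v.
Proof.
elim/(fock_ind fockV): v => [|x v w [d dv] [e ew]|k v [d dv]].
- by exists 1%N => j; apply: (fock_vac_gt0 fockV).
- exists (maxn d e); apply: killed_linear.
    by apply: killed_leq dv; rewrite leq_maxl.
  by apply: killed_leq ew; rewrite leq_maxr.
- by exists d.+1; apply: killed_mode.
Qed.

(** By induction on the length in [killed], all [a j v] with [j > 0] vanish; then [v] has energy 0
    and is a multiple of [vac], with coefficient [vev v = 0]. *)
Lemma fock_nondegenerate (K : V -> Prop) :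
    (forall v, K v -> vev v = 0) ->
    (forall j v, 0 < j -> K v -> K (a j v)) ->
  forall v, K v -> v = 0.
Proof.
move=> K0 Ka v; have [d] := killedP v.
elim: d v => [|d IHd] v /= dv Kv //.
rewrite (@energy_eq0 v) ?K0 ?scale0r // /nrg /energy big1 // => j _.
by rewrite (IHd (a j.+1 v)) ?(lin0 (aL _)) //; [apply: dv|apply: Ka].
Qed.

End VacuumFunctional.

(** * Vertex operators *)

Section OpseriesExp.
Variables (C : numFieldType) (V : lmodType C) (X : opseries V).
Hypotheses (XL : forall p, linear (X p)) (X0 : forall v, X 0%N v = 0).

Let pow i := iter i (opseries_mul X) (@opseries_one C V).

Let powS i p v : pow i.+1 p v = \sum_(b < p.+1) X b (pow i (p - b)%N v).
Proof. by []. Qed.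

Let pow_linear i p : linear (pow i p).
Proof.
elim: i p => [|i IHi] p x v w.
  by rewrite /pow /= /opseries_one; case: ifP; rewrite ?scaler0 ?addr0.
rewrite !powS scaler_sumr -big_split; apply: eq_bigr => b _ /=.
by rewrite IHi XL.
Qed.

Let pow_small i p v : (p < i)%N -> pow i p v = 0.
Proof.
elim: i p v => [//|i IHi] p v pi; rewrite powS big1 // => -[[|b] bp] _ /=.
  by rewrite X0.
by rewrite IHi ?(lin0 (XL _)) //; lia.
Qed.

Lemma opseries_expE n p v : (p < n)%N ->
  opseries_exp X p v = \sum_(i < n) (i`!%:R)^-1 *: pow i p v.
Proof.
move=> /subnKC <-; rewrite big_split_ord [X in _ = _ + X]big1 ?addr0 // => i _.
by rewrite pow_small ?scaler0 //= addSn ltnS leq_addr.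
Qed.

Lemma opseries_exp_linear p : linear (opseries_exp X p).
Proof.
move=> x v w; rewrite /opseries_exp scaler_sumr -big_split; apply: eq_bigr => i _.
by rewrite /opseries_exp_coef -/(pow _) pow_linear scalerDr !scalerA mulrC.
Qed.

Lemma opseries_exp0 v : opseries_exp X 0%N v = v.
Proof.
by rewrite /opseries_exp big_ord1 /opseries_exp_coef /= invr1 scale1r.
Qed.

Lemma opseries_exp_ground v p :
  (forall p, X p v = 0) -> (0 < p)%N -> opseries_exp X p v = 0.
Proof.
move=> Xv p0; rewrite /opseries_exp big1 // => -[i ip] _.
rewrite /opseries_exp_coef -/(pow i).
suff -> : pow i p v = 0 by rewrite scaler0.
have pow_v j r : (0 < j)%N || (0 < r)%N -> pow j r v = 0; last first.
  by apply: pow_v; rewrite p0 orbT.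
elim: j r => [|j IHj] r jr.
  by rewrite /pow /= /opseries_one ifF //; apply/negbTE; rewrite -lt0n.
rewrite powS big1 // => b _.
have [/IHj ->|] := boolP ((0 < j) || (0 < r - b))%N; first by rewrite (lin0 (XL _)).
rewrite negb_or -!eqn0Ngt => /andP[/eqP-> /eqP->].
by rewrite /pow /= /opseries_one /= Xv.
Qed.

(** A term of positive degree comes from a positive power of [X], whose outermost factor is some
    [X b]. Used with the kernel of the vacuum functional as [P]. *)
Lemma opseries_exp_closed (P : V -> Prop) p v :
    P 0 -> (forall x v w, P v -> P w -> P (x *: v + w)) ->
    (forall p v, P (X p v)) -> (0 < p)%N ->
  P (opseries_exp X p v).
Proof.
move=> P0 PL PX p0.
have PD v1 v2 : P v1 -> P v2 -> P (v1 + v2).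
  by move=> P1 P2; rewrite -[v1]scale1r; apply: PL.
apply: big_ind => // -[i ip] _; rewrite /opseries_exp_coef -/(pow i).
rewrite -[_ *: _]addr0; apply: (PL) => //.
case: i {ip} => [|i]; first by rewrite /pow /= /opseries_one gtn_eqF.
by rewrite powS; apply: big_ind.
Qed.

Lemma opseries_exp_rescale (Y : opseries V) z :
  (forall p v, Y p v = z ^+ p *: X p v) ->
  forall p v, opseries_exp Y p v = z ^+ p *: opseries_exp X p v.
Proof.
move=> YX p v; rewrite /opseries_exp scaler_sumr; apply: eq_bigr => i _.
rewrite /opseries_exp_coef -/(pow i) scalerA mulrC -scalerA; congr (_ *: _).
move: (nat_of_ord i) => {i} j; elim: j p v => [|j IHj] p v.
  rewrite /pow /= /opseries_one; case: eqP => [->|_]; last by rewrite scaler0.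
  by rewrite expr0 scale1r.
rewrite powS iterS /opseries_mul scaler_sumr; apply: eq_bigr => b _.
rewrite IHj YX (linZ (XL _)) scalerA -exprD subnKC //.
by rewrite -ltnS.
Qed.

Variables (T : V -> V) (d : nat) (x : C).
Hypotheses (TL : linear T) (d_gt0 : (0 < d)%N).
Hypothesis TX : forall p v, T (X p v) = X p (T v) + (if p == d then x else 0) *: v.

(** The Leibniz rule $[T,X^i]=i\,x\,w^dX^{i-1}$, valid because $[T,X]=xw^d$ is scalar, read off in
    degree [p]. *)
Let pow_comm i p v : T (pow i p v) =
  pow i p (T v) + (if (d <= p)%N then i%:R * x else 0) *: pow i.-1 (p - d)%N v.
Proof.
elim: i p v => [|i IHi] p v.
  rewrite mul0r if_same scale0r addr0 /pow /= /opseries_one.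
  by case: ifP => // _; rewrite (lin0 TL).
rewrite powS (lin_sum TL).
under eq_bigr do rewrite TX IHi (linD (XL _)) (linZ (XL _)).
rewrite !big_split /= -!powS -addrA; congr (_ + _).
case: leqP => dp; last first.
  rewrite scale0r !big1 ?addr0 // => -[b bp] _ /=.
    by rewrite ifF ?scale0r //; apply/negbTE; lia.
  by rewrite ifF ?scale0r //; apply/negbTE; lia.
have dp' : (d < p.+1)%N by [].
rewrite [X in _ + X](bigD1 (Ordinal dp')) //= eqxx [X in _ + (_ + X)]big1; last first.
  move=> b /eqP bd; rewrite ifF ?scale0r //; apply/negbTE/eqP => bd'.
  by apply: bd; apply/val_inj.
rewrite addr0 mulrSr mulrDl mul1r scalerDl; congr (_ + _).
case: i {IHi} => [|i].
  by rewrite !mul0r scale0r big1 // => b _; rewrite if_same scale0r.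
rewrite -[LHS](big_mkord xpredT (fun b => (if (d <= p - b)%N then i.+1%:R * x else 0) *:
   X b (pow i (p - b - d)%N v))).
rewrite (@big_cat_nat _ _ _ (p - d).+1) //=; last by lia.
rewrite [X in _ + X]big_nat_cond [X in _ + X]big1 ?addr0; last first.
  move=> b; rewrite andbT => /andP[b1 b2].
  by rewrite ifF ?scale0r //; apply/negbTE; lia.
rewrite big_mkord /opseries_mul scaler_sumr; apply: eq_bigr => -[b bp] _ /=.
by rewrite ifT; [rewrite subnAC|lia].
Qed.

(** Summing the rule for powers gives $[T,e^X]=x\,w^de^X$. *)
Lemma opseries_exp_comm p v : T (opseries_exp X p v) =
  opseries_exp X p (T v) +
  (if (d <= p)%N then x else 0) *: opseries_exp X (p - d)%N v.
Proof.
rewrite /(opseries_exp X p) (lin_sum TL) /opseries_exp_coef.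
rewrite /(opseries_exp X p) /opseries_exp_coef.
under eq_bigr do rewrite (linZ TL) -/(pow _) pow_comm scalerDr.
rewrite big_split /=; congr (_ + _).
case: leqP => dp; last by rewrite scale0r big1 // => i _; rewrite scale0r scaler0.
rewrite big_ord_recl /= mul0r scale0r scaler0 add0r.
rewrite (@opseries_expE p); last by lia.
rewrite scaler_sumr; apply: eq_bigr => i _ /=.
rewrite !scalerA /bump add1n factS natrM; congr (_ *: _).
by rewrite invfM mulrACA mulVf ?pnatr_eq0 // mul1r mulrC.
Qed.

End OpseriesExp.

(** * Normally ordered exponentials *)

Section Vertex.
Variables (C : numFieldType) (V : lmodType C) (a : int -> V -> V).
Variables (alpha : C) (vac : V).
Hypothesis fockV : is_heisenberg_fock a alpha vac.
Variable f : int -> C.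

Let aL := fock_linear fockV.

Let modes (s : nat -> int) : opseries V :=
  fun p v => if p == 0%N then 0 else f (s p) *: a (s p) v.

Let modes_linear s p : linear (modes s p).
Proof.
move=> x v w; rewrite /modes; case: ifP => _; first by rewrite scaler0 addr0.
by rewrite aL scalerDr !scalerA mulrC.
Qed.

Let modes0 s v : modes s 0%N v = 0. Proof. by []. Qed.

(** Indices range over the integers, with value 0 at negative ones, so that commutation with a mode
    may shift the index without a case distinction. *)
Definition creationz (s : int) : V -> V :=
  if s is Posz p then creation a f p else fun=> 0.

Definition annihilationz (s : int) : V -> V :=
  if s is Posz p then annihilation a f p else fun=> 0.

Lemma creationz_linear s : linear (creationz s).
Proof.
case: s => [p|p] x v w /=; last by rewrite scaler0 addr0.
exact: (opseries_exp_linear (modes_linear (fun p => - p%:Z))).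
Qed.

Lemma annihilationz_linear s : linear (annihilationz s).
Proof.
case: s => [p|p] x v w /=; last by rewrite scaler0 addr0.
exact: (opseries_exp_linear (modes_linear (fun p => p%:Z))).
Qed.

(** For [j > 0] the commutator of [a j] with the exponent is the scalar $jf(-j)w^j$, so
    [opseries_exp_comm] applies; the other modes commute with the exponent. *)
Lemma creationz_comm j s v : a j (creationz s v) =
  creationz s (a j v) + (if 0 < j then j%:~R * f (- j) else 0) *: creationz (s - j) v.
Proof.
case: s => [p|p] /=; last first.
  rewrite (lin0 (aL _)) add0r; case: ifP => [j0|_]; last by rewrite scale0r.
  by have -> : Negz p - j = Negz (p + `|j|) by [lia|]; rewrite scaler0.
(* For [j <= 0] the commutator is 0 and [d] gets the dummy value 1, which keeps it positive. *)
pose d := if 0 < j then `|j|%N else 1%N.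
have d0 : (0 < d)%N by rewrite /d; case: ifP => //; lia.
have := @opseries_exp_comm _ _ _ (modes_linear (fun p => - p%:Z))
  (modes0 _) (a j) d (if 0 < j then j%:~R * f (- j) else 0) (aL j) d0.
rewrite -/(creation a f) => ->.
  have [j0|_] := ltP 0 j; last by rewrite if_same !scale0r.
  congr (_ + _); case: leqP => dp.
    by congr (_ *: _); have -> : p%:Z - j = (p - d)%N by move: dp; rewrite /d j0; lia.
  rewrite scale0r; have -> : p%:Z - j = Negz (d - p).-1; last by rewrite scaler0.
  by move: dp; rewrite /d j0; lia.
move=> r w; rewrite /modes; case: eqP => [->|/eqP r0].
  by rewrite (lin0 (aL j)) ifF ?scale0r ?addr0 //; lia.
rewrite (linZ (aL j)) (fock_comm fockV) scalerDr scalerA; congr (_ + _ *: _).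
case: ifP => [/eqP jr|jr].
  have j0 : 0 < j by lia.
  have -> : (r == d) by rewrite /d j0; lia.
  have jE : j = r by lia.
  by rewrite j0 jE mulrC.
rewrite mulr0; case: ifP => // rd; case: ifP => // j0.
by move: rd; rewrite /d j0; lia.
Qed.

Lemma annihilationz_comm j s v : a j (annihilationz s v) =
  annihilationz s (a j v) +
    (if j < 0 then j%:~R * f (- j) else 0) *: annihilationz (s + j) v.
Proof.
case: s => [p|p] /=; last first.
  rewrite (lin0 (aL _)) add0r; case: ifP => [j0|_]; last by rewrite scale0r.
  by have -> : Negz p + j = Negz (p + `|j|) by [lia|]; rewrite scaler0.
pose d := if j < 0 then `|j|%N else 1%N.
have d0 : (0 < d)%N by rewrite /d; case: ifP => //; lia.
have := @opseries_exp_comm _ _ _ (modes_linear (fun p => p%:Z))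
  (modes0 _) (a j) d (if j < 0 then j%:~R * f (- j) else 0) (aL j) d0.
rewrite -/(annihilation a f) => ->.
  have [j0|_] := ltP j 0; last by rewrite if_same !scale0r.
  congr (_ + _); case: leqP => dp.
    by congr (_ *: _); have -> : p%:Z + j = (p - d)%N by move: dp; rewrite /d j0; lia.
  rewrite scale0r; have -> : p%:Z + j = Negz (d - p).-1; last by rewrite scaler0.
  by move: dp; rewrite /d j0; lia.
move=> r w; rewrite /modes; case: eqP => [->|/eqP r0].
  by rewrite (lin0 (aL j)) ifF ?scale0r ?addr0 //; lia.
rewrite (linZ (aL j)) (fock_comm fockV) scalerDr scalerA; congr (_ + _ *: _).
case: ifP => [/eqP jr|jr].
  have j0 : j < 0 by lia.
  have -> : (r == d) by rewrite /d j0; lia.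
  have rE : r%:Z = - j by lia.
  by rewrite j0 rE mulrC.
rewrite mulr0; case: ifP => // rd; case: ifP => // j0.
by move: rd; rewrite /d j0; lia.
Qed.

Lemma creationz0 v : creationz 0 v = v.
Proof. exact: opseries_exp0. Qed.

Lemma annihilationz0 v : annihilationz 0 v = v.
Proof. exact: opseries_exp0. Qed.

Lemma annihilation_vac (p : nat) : (0 < p)%N -> annihilation a f p vac = 0.
Proof.
move=> p0; apply: (opseries_exp_ground (modes_linear (fun p => p%:Z))) p0 => r.
by rewrite /modes; case: eqP => // r0; rewrite (fock_vac_gt0 fockV) ?scaler0 //; lia.
Qed.

Lemma annihilation_nilpotent v :
  exists B : nat, forall r : nat, (B <= r)%N -> annihilation a f r v = 0.
Proof.
elim/(fock_ind fockV): v => [|x v w [B HB] [B' HB']|l v [B HB]].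
- by exists 1%N => r; apply: annihilation_vac.
- exists (maxn B B') => r; rewrite geq_max => /andP[Br B'r].
  have -> : annihilation a f r (x *: v + w) =
      x *: annihilation a f r v + annihilation a f r w.
    exact: (annihilationz_linear r).
  by rewrite HB // HB' // scaler0 addr0.
- exists (B + `|l|)%N => r rB; have := annihilationz_comm l r v.
  rewrite /= HB; last by lia.
  rewrite (lin0 (aL l)) => /eqP; rewrite eq_sym addrC addr_eq0 => /eqP E.
  apply/eqP; rewrite -oppr_eq0 -E; case: ifP => [l0|]; last by rewrite scale0r.
  have -> : r%:Z + l = (r - `|l|)%N by lia.
  by rewrite /= HB ?scaler0 //; lia.
Qed.

(** The pairs (p, r) with r - p = N are parametrised by [r], and [creationz] vanishes at the values
    of [r] below [N]. *)
Lemma vertexE (B : nat) N v : (forall r : nat, (B <= r)%N -> annihilation a f r v = 0) ->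
  vertex a f N v = \sum_(0 <= r < B) creationz (r%:Z - N) (annihilationz r v).
Proof.
move=> HB; rewrite /vertex.
set rs := [seq (`|r%:Z - N|%N, r) | r <- iota 0 B & N <= r%:Z].
rewrite (@fsbigE _ _ _ _ _ rs).
- rewrite big_mkcond /= /rs big_map big_filter /index_iota subn0.
  rewrite [RHS](bigID (fun r : nat => N <= r%:Z)) /=.
  rewrite [X in _ = _ + X]big1 ?addr0; last first.
    by move=> r rN; have -> : r%:Z - N = Negz `|r%:Z - N|.-1 by lia.
  apply: eq_bigr => r rN; rewrite ifT; last by rewrite inE /=; lia.
  by rewrite [in RHS](_ : r%:Z - N = `|r%:Z - N|%N) //; lia.
- rewrite map_inj_in_uniq ?filter_uniq ?iota_uniq //.
  by move=> r s _ _ [].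
- by move=> pr /mapP[r]; rewrite mem_filter => /andP[rN _] -> /=; lia.
- move=> [p r] /= prN prs; rewrite [annihilation _ _ _ _]HB.
    exact: (lin0 (creationz_linear p)).
  rewrite leqNgt; apply: contra prs => rB; apply/mapP; exists r.
    by rewrite mem_filter mem_iota /= add0n rB andbT; lia.
  by congr (_, _); lia.
Qed.

Lemma vertex_linear N : linear (vertex a f N).
Proof.
move=> x v w; have [B HB] := annihilation_nilpotent v.
have [B' HB'] := annihilation_nilpotent w; pose M := maxn B B'.
have Mv (r : nat) : (M <= r)%N -> annihilation a f r v = 0.
  by rewrite geq_max => /andP[Br _]; apply: HB.
have Mw (r : nat) : (M <= r)%N -> annihilation a f r w = 0.
  by rewrite geq_max => /andP[_ Br]; apply: HB'.
rewrite (vertexE _ Mv) (vertexE _ Mw) (@vertexE M) => [|r Mr]; last first.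
  have -> : annihilation a f r (x *: v + w) =
      x *: annihilation a f r v + annihilation a f r w.
    exact: (annihilationz_linear r).
  by rewrite Mv // Mw // scaler0 addr0.
rewrite scaler_sumr -big_split; apply: eq_bigr => r _.
by rewrite annihilationz_linear creationz_linear.
Qed.

Lemma vertex_vacE N : vertex a f N vac = creationz (- N) vac.
Proof.
rewrite (@vertexE 1) => [|r]; last exact: annihilation_vac.
by rewrite big_nat1 annihilationz0 sub0r.
Qed.

Lemma vertex_vac N : 0 <= N -> vertex a f N vac = if N == 0 then vac else 0.
Proof.
move=> N0; rewrite vertex_vacE; case: eqP => [->|N0'].
  by rewrite oppr0 creationz0.
by have -> : - N = Negz `|N|.-1 by lia.
Qed.

Lemma vev_creation_series (p : nat) v :
  (0 < p)%N -> vev fockV (creation a f p v) = 0.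
Proof.
apply: (opseries_exp_closed (X := modes (fun p => - p%:Z))
  (P := fun v => vev fockV v = 0)).
- exact: vev0.
- by move=> x {}v w v0 w0; rewrite vev_linear v0 w0 mulr0 addr0.
- move=> {}p {}v; rewrite /modes; case: eqP => p0; first exact: vev0.
  by rewrite vevZ vev_creation ?mulr0 //; lia.
Qed.

Lemma vev_vertex_lt0 N v : N < 0 -> vev fockV (vertex a f N v) = 0.
Proof.
move=> N0; have [B HB] := annihilation_nilpotent v.
rewrite (vertexE _ HB) vev_sum big1 // => r _.
have -> : r%:Z - N = (r + `|N|)%N by lia.
by apply: vev_creation_series; lia.
Qed.

Lemma vev_vertex_vac N : N != 0 -> vev fockV (vertex a f N vac) = 0.
Proof.
move=> N0; have [N1|] := leP 0 N; last exact: vev_vertex_lt0.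
by rewrite vertex_vac // (negPf N0) vev0.
Qed.

(** For [j > 0] the extra term comes from the creation half, for [j < 0] from the annihilation
    half. *)
Lemma vertex_comm j N v : a j (vertex a f N v) =
  vertex a f N (a j v) + (j%:~R * f (- j)) *: vertex a f (N + j) v.
Proof.
have [B HB] := annihilation_nilpotent v.
have [B' HB'] := annihilation_nilpotent (a j v); pose M := (maxn B B' + `|j|)%N.
have Mv (r : nat) : (M <= r)%N -> annihilation a f r v = 0.
  by move=> Mr; apply: HB; lia.
have Maj (r : nat) : (M <= r)%N -> annihilation a f r (a j v) = 0.
  by move=> Mr; apply: HB'; lia.
rewrite (vertexE _ Mv) (vertexE _ Maj) (lin_sum (aL j)).
have [j0|j0|->] := ltrgtP j 0.
- have MJ (r : nat) : (M - `|j| <= r)%N -> annihilation a f r v = 0.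
    by move=> Mr; apply: HB; lia.
  under eq_bigr do rewrite creationz_comm lt_gtF // scale0r addr0 annihilationz_comm j0
    (linD (creationz_linear _)) (linZ (creationz_linear _)).
  rewrite big_split /= (vertexE _ MJ) -scaler_sumr; congr (_ + _ *: _).
  rewrite (@big_cat_nat _ _ _ `|j|%N) //=; last by lia.
  rewrite big_nat_cond big1 ?add0r; last first.
    move=> r; rewrite andbT => /andP[_ rj].
    have -> : r%:Z + j = Negz (`|j| - r).-1 by lia.
    exact: (lin0 (creationz_linear _)).
  rewrite -{1}[`|j|%N]add0n big_addn; apply: eq_bigr => r _.
  have -> : (r + `|j|)%N%:Z + j = r by lia.
  by have -> : (r + `|j|)%N%:Z - N = r%:Z - (N + j) by lia.
- under eq_bigr do rewrite creationz_comm annihilationz_comm j0 lt_gtF // scale0r addr0.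
  rewrite big_split /= (vertexE _ Mv) -scaler_sumr; congr (_ + _ *: _).
  by apply: eq_bigr => r _; have -> : r%:Z - N - j = r%:Z - (N + j) by lia.
- rewrite mul0r scale0r addr0; apply: eq_bigr => r _.
  by rewrite creationz_comm annihilationz_comm ltxx !scale0r !addr0.
Qed.

End Vertex.

(** * Change of variable in vertex operators *)

Section VertexRescale.
Variables (C : numFieldType) (V : lmodType C) (a : int -> V -> V).
Variables (alpha : C) (vac : V).
Hypothesis fockV : is_heisenberg_fock a alpha vac.
Variables (f : int -> C) (z : C).
Hypothesis z0 : z != 0.

Let modes (h : int -> C) (s : nat -> int) : opseries V :=
  fun p v => if p == 0%N then 0 else h (s p) *: a (s p) v.

Let modes_linear h s p : linear (modes h s p).
Proof.
move=> x v w; rewrite /modes; case: ifP => _; first by rewrite scaler0 addr0.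
by rewrite (fock_linear fockV) scalerDr !scalerA mulrC.
Qed.

Let g j := f j * z ^ (- j).

Let creation_rescale p w : creation a g p w = z ^+ p *: creation a f p w.
Proof.
apply: (opseries_exp_rescale (modes_linear f (fun p => - p%:Z))) => i {}w.
rewrite /modes; case: eqP => _; first by rewrite scaler0.
by rewrite /g opprK scalerA mulrC.
Qed.

Let annihilation_rescale r w :
  annihilation a g r w = z^-1 ^+ r *: annihilation a f r w.
Proof.
apply: (opseries_exp_rescale (modes_linear f (fun p => p%:Z))) => i {}w.
rewrite /modes; case: eqP => _; first by rewrite scaler0.
by rewrite /g scalerA mulrC exprVn -exprnN.
Qed.

(** These coefficients arise from substituting $zw$ for $w$. *)
Lemma vertex_rescale N v :
  vertex a (fun j => f j * z ^ (- j)) N v = z ^ (- N) *: vertex a f N v.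
Proof.
have [B HB] := annihilation_nilpotent fockV f v.
rewrite -/g (vertexE fockV N HB) (@vertexE _ _ _ _ _ fockV g B) => [|r rB]; last first.
  by rewrite annihilation_rescale HB ?scaler0.
rewrite scaler_sumr; apply: eq_bigr => r _ /=; rewrite annihilation_rescale.
rewrite (linZ (creationz_linear fockV _ _)).
case E : (r%:Z - N) => [p|p] /=; last by rewrite !scaler0.
rewrite creation_rescale scalerA; congr (_ *: _).
have -> : - N = p%:Z - r%:Z by rewrite -E; ring.
by rewrite expfzDr // exprVn -exprnN mulrC.
Qed.

End VertexRescale.

(** * Two-point functions *)

Section OperatorFamilies.
Variables (C : numFieldType) (V : lmodType C) (a : int -> V -> V).
Variables (alpha : C) (vac : V).
Hypothesis fockV : is_heisenberg_fock a alpha vac.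

Let aL := fock_linear fockV.
Let phi := vev fockV.

(** Creation modes can be moved to the left of [D l s], where the functional kills them, so the
    functional vanishes on all values of the family. The span of these values is stable under the
    modes, hence zero by [fock_nondegenerate]. *)
Lemma operators_eq0 (D : int -> int -> V -> V) (x z : int -> C) :
    (forall l s, linear (D l s)) ->
    (forall j l s v, a j (D l s v) =
       D l s (a j v) + (x j *: D (l + j) s v + z j *: D l (s + j) v)) ->
    (forall l s, phi (D l s vac) = 0) ->
  forall l s v, D l s v = 0.
Proof.
move=> DL Da Dvac l s v.
have phiD : forall w i j, phi (D i j w) = 0.
  move=> w; elim/(fock_creation_ind fockV): w => [|t w w' Pw Pw'|k w k0 Pw] i j //.
    by rewrite DL /phi vev_linear -/phi Pw Pw' mulr0 addr0.
  have -> : D i j (a k w) =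
      a k (D i j w) - (x k *: D (i + k) j w + z k *: D i (j + k) w).
    by rewrite Da addrK.
  by rewrite /phi vevB vevD !vevZ vev_creation // -/phi !Pw !mulr0 !addr0 subr0.
pose K w := exists e : seq (int * int * V), w = \sum_(p <- e) D p.1.1 p.1.2 p.2.
apply: (fock_nondegenerate (fockV := fockV) (K := K)) => [w [e ->]|j w _ [e ->]|].
- by rewrite vev_sum big1 // => p _; apply: phiD.
- exists ([seq (p.1, a j p.2) | p <- e] ++
    ([seq (p.1.1 + j, p.1.2, x j *: p.2) | p <- e] ++
     [seq (p.1.1, p.1.2 + j, z j *: p.2) | p <- e])).
  rewrite !big_cat !big_map /= (lin_sum (aL j)) -!big_split /=.
  by apply: eq_bigr => p _; rewrite Da !(linZ (DL _ _)).
- by exists [:: (l, s, v)]; rewrite big_seq1.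
Qed.

End OperatorFamilies.

(** * Taylor coefficients of rational functions *)

Section GeometricSums.
Variable C : numFieldType.

(* The recursion determines the Taylor coefficients of the exponential of
   [\sum_j e j / j * x ^ j]. *)
Lemma exp_recursion_unique (e G H : nat -> C) :
    G 0%N = H 0%N ->
    (forall l, l.+1%:R * G l.+1 = \sum_(m < l.+1) e m.+1 * G (l - m)%N) ->
    (forall l, l.+1%:R * H l.+1 = \sum_(m < l.+1) e m.+1 * H (l - m)%N) ->
  forall l, G l = H l.
Proof.
move=> GH0 GE HE; elim/ltn_ind => -[//|l] IHl.
apply: (@mulfI _ l.+1%:R); first by rewrite pnatr_eq0.
by rewrite GE HE; apply: eq_bigr => m _; rewrite IHl // ltnS leq_subr.
Qed.

Lemma geometric_sum2 (x z : C) l :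
  (z - x) * (\sum_(m < l) x ^+ m.+1 * z ^+ (l - m)) =
  x * z ^+ l.+1 - x ^+ l.+1 * z.
Proof.
elim: l => [|l IHl]; first by rewrite big_ord0 mulr0 !expr1 subrr.
rewrite big_ord_recr /= subSnn expr1.
have -> : \sum_(i < l) x ^+ i.+1 * z ^+ (l.+1 - i) =
          z * \sum_(i < l) x ^+ i.+1 * z ^+ (l - i).
  rewrite mulr_sumr; apply: eq_bigr => i _.
  by rewrite subSn 1?ltnW // [z ^+ _.+1]exprS mulrCA.
rewrite mulrDr mulrCA IHl !exprS; ring.
Qed.

Lemma arithmetic_geometric_sum (x : C) l :
  (1 - x) ^+ 2 * (\sum_(m < l) (l - m)%:R * x ^+ m.+1) =
  x ^+ l.+2 - l.+1%:R * x ^+ 2 + l%:R * x.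
Proof.
elim: l => [|l IHl]; first by rewrite big_ord0; ring.
have -> : \sum_(m < l.+1) (l.+1 - m)%:R * x ^+ m.+1 =
    (\sum_(m < l) (l - m)%:R * x ^+ m.+1) + \sum_(m < l.+1) x ^+ m.+1.
  rewrite [X in _ = X + _](_ : _ = \sum_(m < l.+1) (l - m)%:R * x ^+ m.+1).
    rewrite -big_split; apply: eq_bigr => m _ /=.
    by rewrite (subSn (leq_ord m)) mulrSr mulrDl mul1r.
  by rewrite big_ord_recr /= subnn mul0r addr0.
rewrite mulrDr IHl.
have -> : \sum_(m < l.+1) x ^+ m.+1 = x * \sum_(m < l.+1) x ^+ m.
  by rewrite mulr_sumr; apply: eq_bigr => m _; rewrite exprS.
have E : (1 - x) * \sum_(m < l.+1) x ^+ m = 1 - x ^+ l.+1.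
  by rewrite -[1 in RHS](expr1n _ l.+1) subrXX; congr (_ * _); apply: eq_bigr => m _;
     rewrite expr1n mul1r.
have -> : (1 - x) ^+ 2 * (x * \sum_(m < l.+1) x ^+ m) =
   (1 - x) * x * ((1 - x) * \sum_(m < l.+1) x ^+ m) by ring.
by rewrite E !exprS; ring.
Qed.

(* In the next two lemmas the weights [e] make [\sum_j e j / j * x ^ j] the
   logarithm of (1 - s x) (1 - x / s) / ((1 - t x) (1 - x / t)), with t = 1 in
   the second one; the claim is the expansion of [g 0] times this rational
   function. *)
Lemma two_point_simple_poles (s t : C) (g : nat -> C) :
    s != 0 -> t != 0 -> 1 - t * s != 0 -> 1 - t / s != 0 -> 1 - t ^+ 2 != 0 ->
    g 0%N = ((1 - t * s) * (1 - t / s))^-1 ->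
    (forall l, l.+1%:R * g l.+1 = \sum_(m < l.+1)
       (t^-1 ^+ m.+1 + t ^+ m.+1 - s ^+ m.+1 - s^-1 ^+ m.+1) * g (l - m)%N) ->
  forall l, g l.+1 = (t^-1 ^+ l.+1 - t ^+ l.+1) / (1 - t ^+ 2).
Proof.
move=> s0 t0 ts0 ts0' t20 g0 gE l.
pose H (l : nat) : C := if l is 0%N then ((1 - t * s) * (1 - t / s))^-1 else
  (t^-1 ^+ l - t ^+ l) / (1 - t ^+ 2).
suff HE l' : l'.+1%:R * H l'.+1 = \sum_(m < l'.+1)
    (t^-1 ^+ m.+1 + t ^+ m.+1 - s ^+ m.+1 - s^-1 ^+ m.+1) * H (l' - m)%N.
  exact: (exp_recursion_unique
    (e := fun j => t^-1 ^+ j + t ^+ j - s ^+ j - s^-1 ^+ j) g0 gE HE l.+1).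
rewrite big_ord_recr /= subnn.
(* The products of powers of the same $t$ or $t^{-1}$ give summands independent of [m]; the others
   are convolutions of geometric sequences, which [geometric_sum2] evaluates. *)
have -> : \sum_(m < l') (t^-1 ^+ m.+1 + t ^+ m.+1 - s ^+ m.+1 - s^-1 ^+ m.+1)
      * H (l' - m)%N =
   (\sum_(m < l') (t^-1 ^+ l'.+1 - t ^+ l'.+1)
    + (\sum_(m < l') t ^+ m.+1 * t^-1 ^+ (l' - m)
       - \sum_(m < l') t^-1 ^+ m.+1 * t ^+ (l' - m))
    - \sum_(m < l') s ^+ m.+1 * t^-1 ^+ (l' - m)
    - \sum_(m < l') s^-1 ^+ m.+1 * t^-1 ^+ (l' - m)
    + \sum_(m < l') s ^+ m.+1 * t ^+ (l' - m)
    + \sum_(m < l') s^-1 ^+ m.+1 * t ^+ (l' - m)) / (1 - t ^+ 2).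
  rewrite -!sumrB -!big_split -!sumrB -!big_split -?sumrB -?big_split /= mulr_suml.
  apply: eq_bigr => -[m ml] _ /=.
  have -> : H (l' - m)%N = (t^-1 ^+ (l' - m) - t ^+ (l' - m)) / (1 - t ^+ 2).
    by case E : (l' - m)%N => //; lia.
  have E (x : C) : x ^+ l'.+1 = x ^+ m.+1 * x ^+ (l' - m).
    by rewrite -exprD; congr (_ ^+ _); lia.
  by rewrite !E; ring.
have P (x z : C) : z - x != 0 -> \sum_(m < l') x ^+ m.+1 * z ^+ (l' - m) =
    (x * z ^+ l'.+1 - x ^+ l'.+1 * z) / (z - x).
  by move=> xz; rewrite -geometric_sum2 mulrAC divff ?mul1r.
have st : t - s != 0.
  by apply: contra ts0'; rewrite subr_eq0 => /eqP->; rewrite divff // subrr.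
have tt : t^-1 - t != 0.
  apply: contra t20; rewrite subr_eq0 => /eqP E.
  by rewrite expr2 -{1}E mulVf // subrr.
have tt' : t - t^-1 != 0 by rewrite -opprB oppr_eq0.
have ts : t^-1 - s != 0.
  by apply: contra ts0; rewrite subr_eq0 => /eqP <-; rewrite divff // subrr.
have ts' : t - s^-1 != 0.
  by apply: contra ts0; rewrite subr_eq0 => /eqP ->; rewrite mulVf // subrr.
have st' : t^-1 - s^-1 != 0.
  by apply: contra st; rewrite !subr_eq0 (inj_eq invr_inj).
rewrite !P // sumr_const card_ord -[_ *+ l']mulr_natr /H.
have T0 : t ^+ l'.+1 != 0 by rewrite expf_neq0.
have S0 : s ^+ l'.+1 != 0 by rewrite expf_neq0.
rewrite !exprVn; move: (t ^+ l'.+1) (s ^+ l'.+1) T0 S0 => T S T0 S0.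
have st1 : s - t != 0 by rewrite -opprB oppr_eq0.
have ts1 : t * s - 1 != 0 by rewrite -opprB oppr_eq0.
have t21 : t ^+ 2 - 1 != 0 by rewrite -opprB oppr_eq0.
rewrite [l'.+1%:R]mulrSr; field.
by rewrite ?ts0 ?t0 ?s0 ?st ?t20 ?T0 ?S0 ?ts1 ?t21 ?st1 /=.
Qed.

Lemma two_point_double_pole (s : C) (g : nat -> C) :
    s != 0 -> 1 - s != 0 ->
    g 0%N = ((1 - s) * (1 - s^-1))^-1 ->
    (forall l, l.+1%:R * g l.+1 = \sum_(m < l.+1)
       (2 - s ^+ m.+1 - s^-1 ^+ m.+1) * g (l - m)%N) ->
  forall l, g l.+1 = l.+1%:R.
Proof.
move=> s0 s1 g0 gE l.
pose H (l : nat) : C := if l is 0%N then ((1 - s) * (1 - s^-1))^-1 else l%:R.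
suff HE l' : l'.+1%:R * H l'.+1 = \sum_(m < l'.+1)
    (2 - s ^+ m.+1 - s^-1 ^+ m.+1) * H (l' - m)%N.
  exact: (exp_recursion_unique (e := fun j => 2 - s ^+ j - s^-1 ^+ j) g0 gE HE l.+1).
rewrite big_ord_recr /= subnn.
have -> : \sum_(m < l') (2 - s ^+ m.+1 - s^-1 ^+ m.+1) * H (l' - m)%N =
   2 * (\sum_(m < l') (l' - m)%:R * 1 ^+ m.+1)
   - \sum_(m < l') (l' - m)%:R * s ^+ m.+1
   - \sum_(m < l') (l' - m)%:R * s^-1 ^+ m.+1.
  rewrite mulr_sumr -!sumrB; apply: eq_bigr => -[m ml] _ /=.
  have -> : H (l' - m)%N = (l' - m)%:R by case E : (l' - m)%N => //; lia.
  by rewrite expr1n; ring.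
have Q (x : C) : 1 - x != 0 -> \sum_(m < l') (l' - m)%:R * x ^+ m.+1 =
    (x ^+ l'.+2 - l'.+1%:R * x ^+ 2 + l'%:R * x) / (1 - x) ^+ 2.
  by move=> x1; rewrite -arithmetic_geometric_sum mulrAC divff ?mul1r // expf_neq0.
(* At $x=1$ the identity [arithmetic_geometric_sum] reads 0 = 0, so this sum is computed by its own
   induction. *)
have Q1 : 2 * (\sum_(m < l') (l' - m)%:R * 1 ^+ m.+1) = l'.+1%:R * l'%:R :> C.
  elim: l' {Q} => [|l' IHl]; first by rewrite big_ord0; ring.
  rewrite big_ord_recl /= mulrDr.
  rewrite (eq_bigr (fun m : 'I_l' => (l' - m)%:R * 1 ^+ m.+1)); last first.
    by move=> m _; rewrite /bump add1n subSS !expr1n.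
  by rewrite IHl expr1n subn0 !mulrSr; ring.
have s1' : 1 - s^-1 != 0.
  by apply: contra s1; rewrite !subr_eq0 eq_sym invr_eq1 eq_sym.
rewrite Q1 !Q // /H ![_ ^+ l'.+2]exprS.
have S0 : s ^+ l'.+1 != 0 by rewrite expf_neq0.
rewrite !exprVn; move: (s ^+ l'.+1) S0 => S S0.
have s2 : s - 1 != 0 by rewrite -opprB oppr_eq0.
rewrite ![l'.+1%:R]mulrSr; field.
by rewrite ?s0 ?s1 ?s2 ?S0.
Qed.

End GeometricSums.

(** * Unnormalised q-integers *)

Section QInt.
Variables (C : numFieldType) (y : C).
Hypothesis y0 : y != 0.

(** The symmetric q-integer at base [y], without its denominator and with the opposite sign. *)
Definition qint (i : int) : C := y ^ (- i) - y ^ i.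

Lemma qintN i : qint (- i) = - qint i.
Proof. by rewrite /qint opprK opprB. Qed.

Lemma qint0 : qint 0 = 0.
Proof. by rewrite /qint oppr0 subrr. Qed.

Lemma qint_sub (i j : int) : y ^ (i - j) - y ^ (j - i) = qint (j - i).
Proof. by rewrite /qint opprB. Qed.

(** The Jacobi identity for [E_{0,j}], [E_{k,i}] and [E_{r,i'}] on the level of structure
    constants. *)
Lemma qint_jacobi (i i' j k r : int) :
  qint (i * r - i' * k) * qint (j * (k + r)) =
  qint (j * k) * qint ((i + j) * r - i' * k)
  + qint (j * r) * qint (i * r - (i' + j) * k).
Proof.
have -> : (i + j) * r - i' * k = (i * r - i' * k) + j * r by ring.
have -> : i * r - (i' + j) * k = (i * r - i' * k) - j * k by ring.
rewrite [j * (k + r)]mulrDr; move: (i * r - i' * k) (j * k) (j * r) => A K R.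
rewrite /qint !opprD !expfzDr // opprK -!invr_expz.
have := expfz_neq0 A y0; have := expfz_neq0 K y0; have := expfz_neq0 R y0.
move: (y ^ A) (y ^ K) (y ^ R) => ? ? ? ? ? ?; field.
by apply/and3P.
Qed.

Hypothesis y_nroot : forall k : int, k != 0 -> y ^ k != 1.

Lemma sub1_expz_neq0 k : k != 0 -> 1 - y ^ k != 0.
Proof. by move=> k0; rewrite subr_eq0 eq_sym y_nroot. Qed.

Lemma qint_neq0 k : k != 0 -> qint k != 0.
Proof.
move=> k0; have : 1 - y ^ (2 * k) != 0 by apply: sub1_expz_neq0; lia.
apply: contra; rewrite /qint subr_eq0 => /eqP E.
by rewrite mulrDl mul1r expfzDr // -{1}E -expfzDr // addNr subrr.
Qed.

End QInt.

(** * The operators of the Fock module and their two-point functions *)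

Section FockOperators.
Variables (C : numFieldType) (V : lmodType C) (a : int -> V -> V).
Variables (alpha : C) (vac : V).
Hypothesis fockV : is_heisenberg_fock a alpha vac.
Variables (y u : C).
Hypotheses (y0 : y != 0) (u0 : u != 0).
Hypothesis y_nroot : forall k : int, k != 0 -> y ^ k != 1.

Let aL := fock_linear fockV.

(* With q = y^2, this is the action of E_{k,l} on F_u; the defining formulas of
   F_u are the cases k = 0, 1, -1. *)
Definition fock_op (k l : int) (v : V) : V :=
  if k == 0 then a l v else
  (u ^ k / (1 - y ^ (2 * k))) *: vertex a (fun j => qint y (k * j) / j%:~R) l v.

Lemma fock_op0 l v : fock_op 0 l v = a l v.
Proof. by rewrite /fock_op eqxx. Qed.

Lemma fock_op_linear k l : linear (fock_op k l).
Proof.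
move=> x v w; rewrite /fock_op; case: ifP => _; first exact: aL.
by rewrite (vertex_linear fockV) scalerDr !scalerA mulrC.
Qed.

Lemma fock_op_comm k j l v : k != 0 ->
  a j (fock_op k l v) = fock_op k l (a j v) + qint y (j * k) *: fock_op k (l + j) v.
Proof.
move=> k0; rewrite /fock_op (negPf k0) (linZ (aL j)) (vertex_comm fockV).
rewrite scalerDr !scalerA; congr (_ + _ *: _); rewrite mulrC; congr (_ * _).
have [->|j0] := eqVneq j 0; first by rewrite mulr0z !mul0r qint0.
rewrite mulrN qintN mulrNz invrN mulrNN mulrC mulfVK ?intr_eq0 //.
by rewrite [k * j]mulrC.
Qed.

Lemma fock_op_vac k l : k != 0 -> 0 <= l ->
  fock_op k l vac = (if l == 0 then u ^ k / (1 - y ^ (2 * k)) else 0) *: vac.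
Proof.
move=> k0 l0; rewrite /fock_op (negPf k0) (vertex_vac fockV) //.
by case: ifP; rewrite ?scaler0 ?scale0r.
Qed.

Lemma vev_fock_op_vac k l : l != 0 -> vev fockV (fock_op k l vac) = 0.
Proof.
move=> l0; rewrite /fock_op; case: ifP => _; last first.
  by rewrite vevZ vev_vertex_vac ?mulr0.
have [l1|l1|] := ltrgtP l 0; last by move/eqP; rewrite (negPf l0).
  exact: vev_creation.
by rewrite (fock_vac_gt0 fockV) // vev0.
Qed.

Lemma vev_fock_op_lt0 k l v : l < 0 -> vev fockV (fock_op k l v) = 0.
Proof.
move=> l0; rewrite /fock_op; case: ifP => _; first exact: vev_creation.
by rewrite vevZ vev_vertex_lt0 ?mulr0.
Qed.

(** The defect [D] has closed commutators with the modes, so [operators_eq0] gives the claim without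
    expanding the exponentials. *)
Lemma energy_fock_op k l v :
  energy fockV (fock_op k l v) =
  fock_op k l (energy fockV v) - l%:~R *: fock_op k l v.
Proof.
have [->|k0] := eqVneq k 0; first by rewrite !fock_op0 energy_mode.
pose D (i _ : int) w :=
  energy fockV (fock_op k i w) - fock_op k i (energy fockV w) + i%:~R *: fock_op k i w.
suff : D l 0 v = 0.
  by move/eqP; rewrite addr_eq0 subr_eq addrC => /eqP.
have nL := energy_linear fockV; have XL i := fock_op_linear k i.
have aE j w : a j (energy fockV w) = energy fockV (a j w) + j%:~R *: a j w.
  by rewrite energy_mode subrK.
apply: (operators_eq0 (fockV := fockV) (D := D)
  (x := fun j => qint y (j * k)) (z := fun=> 0)).
- move=> i i'; apply: linear_fun_add; last exact: linear_fun_scale.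
  by apply: linear_fun_sub; apply: linear_fun_comp.
- move=> j i i' w; rewrite scale0r addr0 /D.
  rewrite (linD (aL j)) (linB (aL j)) (linZ (aL j)) aE !fock_op_comm // aE.
  rewrite (linD nL) (linZ nL) (linD (XL _)) (linZ (XL _)) !scalerDr.
  rewrite scalerN intrD [(i%:~R + _) *: _]scalerDl scalerDr ![qint _ _ *: (_%:~R *: _)]scalerA.
  rewrite ![qint _ _ * _]mulrC -!scalerA !opprD !addrA.
  by rewrite [LHS](ACl (1*5*8*2*7*9*4*(3*6))%AC) /= subrr addr0.
- move=> i i'; rewrite /D energy_vac (lin0 (XL i)) subr0 vevD vev_energy add0r vevZ.
  have [->|i0] := eqVneq i 0; first by rewrite mulr0z mul0r.
  by rewrite vev_fock_op_vac ?mulr0.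
Qed.

(** The energy operator is applied to [fock_op k (- l) vac] in two ways: by its eigenvalue [l], and
    as the sum of the $a_{-j}a_j$, where [a j] acts by its commutator because it kills [vac]. *)
Lemma fock_op_vac_recursion k (l : nat) : k != 0 ->
  l%:R *: fock_op k (- l%:Z) vac =
  \sum_(m < l) qint y (m.+1%:Z * k) *:
    a (- m.+1%:Z) (fock_op k (- (l - m.+1)%N%:Z) vac).
Proof.
move=> k0; have XL i := fock_op_linear k i.
have Ea (j : nat) : a j.+1 (fock_op k (- l%:Z) vac) =
    qint y (j.+1%:Z * k) *: fock_op k (j.+1%:Z - l%:Z) vac.
  rewrite fock_op_comm // (fock_vac_gt0 fockV) // (lin0 (XL _)) add0r.
  by rewrite [- _ + _]addrC.
have -> : l%:R *: fock_op k (- l%:Z) vac = energy fockV (fock_op k (- l%:Z) vac).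
  by rewrite energy_fock_op energy_vac (lin0 (XL _)) sub0r -scaleNr mulrNz opprK.
rewrite (@energyE _ _ _ _ _ fockV l) => [|m lm]; last first.
  rewrite Ea fock_op_vac //; last by lia.
  by rewrite ifF ?scale0r ?scaler0 //; lia.
apply: eq_bigr => m _; rewrite Ea (linZ (aL _)); have lm := ltn_ord m.
by have -> : m.+1%:Z - l%:Z = - (l - m.+1)%N%:Z by lia.
Qed.

(** After [fock_op_vac_recursion], the creation mode is moved to the left of [fock_op k l]; the
    functional kills it there and only the commutator remains. *)
Lemma two_point_recursion k r (l : nat) : k != 0 -> r != 0 ->
  l%:R * vev fockV (fock_op k l (fock_op r (- l%:Z) vac)) =
  \sum_(m < l) qint y (m.+1%:Z * k) * qint y (m.+1%:Z * r) *
    vev fockV (fock_op k (l - m.+1)%N (fock_op r (- (l - m.+1)%N%:Z) vac)).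
Proof.
move=> k0 r0; have XL i := fock_op_linear k i.
rewrite -vevZ -(linZ (XL _)) fock_op_vac_recursion // (lin_sum (XL _)) vev_sum.
apply: eq_bigr => m _; rewrite (linZ (XL _)) vevZ.
have -> w : fock_op k l (a (- m.+1%:Z) w) = a (- m.+1%:Z) (fock_op k l w) +
    qint y (m.+1%:Z * k) *: fock_op k (l%:Z - m.+1%:Z) w.
  by rewrite fock_op_comm // mulNr qintN scaleNr addrNK.
rewrite vevD vev_creation // add0r vevZ mulrCA mulrA.
have lm := ltn_ord m.
by have -> : l%:Z - m.+1%:Z = (l - m.+1)%N by lia.
Qed.

(** With $t=y^{k+r}$ and $s=y^{k-r}$ the weight of the recursion at $j$ is $t^{-j}+t^j-s^j-s^{-j}$.
    For $k+r=0$ the two poles merge at 1 and produce the central term. *)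
Lemma two_point k r (l : nat) : k != 0 -> r != 0 ->
  vev fockV (fock_op k l.+1 (fock_op r (- l.+1%:Z) vac)) =
  if k + r == 0 then l.+1%:R else
    (y ^ (- (l.+1%:Z * (k + r))) - y ^ (l.+1%:Z * (k + r)))
    * (u ^ (k + r) / (1 - y ^ (2 * (k + r)))).
Proof.
move=> k0 r0; have XL k i := fock_op_linear k i.
pose G (l : nat) := vev fockV (fock_op k l (fock_op r (- l%:Z) vac)).
have GE i : i.+1%:R * G i.+1 = \sum_(m < i.+1)
    qint y (m.+1%:Z * k) * qint y (m.+1%:Z * r) * G (i - m)%N.
  exact: two_point_recursion.
have G0 : G 0%N = u ^ (k + r) / ((1 - y ^ (2 * k)) * (1 - y ^ (2 * r))).
  rewrite /G oppr0 !fock_op_vac // eqxx (linZ (XL _ _)) fock_op_vac // eqxx.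
  rewrite !vevZ vev_vac mulr1 expfzDr // invfM [RHS]mulrACA mulrC.
  by [].
rewrite -/(G l.+1).
have ym0 i : y ^ i != 0 by rewrite expfz_neq0.
have yV i : y ^ (- i) = (y ^ i)^-1 by rewrite invr_expz.
have yX (i : int) (m : nat) : (y ^ i) ^+ m = y ^ (m%:Z * i).
  by rewrite mulrC -exprz_exp.
case: eqP => [kr|/eqP kr].
  have rE : r = - k by lia.
  apply: (two_point_double_pole (s := y ^ (2 * k))) => //.
  - by apply: (sub1_expz_neq0 y_nroot); lia.
  - by rewrite G0 kr mul1r rE mulrN yV.
  - move=> i; rewrite GE; apply: eq_bigr => m _; congr (_ * _).
    rewrite exprVn yX mulrCA mulr_natl mulr2n expfzDr //.
    rewrite rE mulrN qintN /qint yV; have := ym0 (m.+1%:Z * k).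
    by move: (y ^ _) => w w0; field.
have := @two_point_simple_poles C (y ^ (k - r)) (y ^ (k + r))
  (fun i => G i / u ^ (k + r)) (ym0 _) (ym0 _).
have -> : y ^ (k + r) * y ^ (k - r) = y ^ (2 * k).
  by rewrite -expfzDr //; congr (_ ^ _); lia.
have -> : y ^ (k + r) / y ^ (k - r) = y ^ (2 * r).
  by rewrite -yV -expfzDr //; congr (_ ^ _); lia.
have -> : (y ^ (k + r)) ^+ 2 = y ^ (2 * (k + r)) by rewrite yX.
have ukr : u ^ (k + r) != 0 by rewrite expfz_neq0.
move=> H; have {H} : G l.+1 / u ^ (k + r) =
    ((y ^ (k + r))^-1 ^+ l.+1 - (y ^ (k + r)) ^+ l.+1) / (1 - y ^ (2 * (k + r))).
  apply: H.
  - by apply: (sub1_expz_neq0 y_nroot); lia.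
  - by apply: (sub1_expz_neq0 y_nroot); lia.
  - by apply: (sub1_expz_neq0 y_nroot); lia.
  - by rewrite G0 mulrAC divff ?mul1r.
  - move=> i; rewrite mulrA GE mulr_suml; apply: eq_bigr => m _.
    rewrite -mulrA; congr (_ * _); rewrite !exprVn !yX [_ * (k + r)]mulrDr [_ * (k - r)]mulrBr.
    rewrite /qint !expfzDr // !yV.
    have := ym0 (m.+1%:Z * k); have := ym0 (m.+1%:Z * r).
    by move: (y ^ _) (y ^ _) => w w' w0 w0'; field; rewrite w0 w0'.
move=> /(canRL (mulfVK ukr)) ->; rewrite exprVn yX yV.
by rewrite mulrA mulrAC.
Qed.

End FockOperators.

(** * The bracket relations *)

Section FockBracket.
Variables (C : numFieldType) (V : lmodType C) (a : int -> V -> V).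
Variables (alpha : C) (vac : V).
Hypothesis fockV : is_heisenberg_fock a alpha vac.
Variables (y u : C).
Hypotheses (y0 : y != 0) (u0 : u != 0).
Hypothesis y_nroot : forall k : int, k != 0 -> y ^ k != 1.

Let aL := fock_linear fockV.
Let XL k l : linear (fock_op a y u k l) := fock_op_linear fockV y u k l.
Notation X := (fock_op a y u).

(** The vector has energy $-(l+s)$, and the functional kills the image of the energy operator. *)
Lemma vev_two_point_neq0 k r l s : l + s != 0 ->
  vev fockV (X k l (X r s vac)) = 0.
Proof.
move=> ls; have := vev_energy fockV (X k l (X r s vac)).
rewrite !energy_fock_op // energy_vac !(lin0 (XL _ _)) sub0r.
rewrite (linN (XL _ _)) (linZ (XL _ _)) -scaleNr -scalerBl -opprD vevZ => /eqP.
by rewrite mulf_eq0 oppr_eq0 -intrD intr_eq0 addrC (negPf ls) => /eqP.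
Qed.

Lemma vev_bracket_gt0 k r l : k != 0 -> r != 0 -> 0 < l ->
  vev fockV (X k l (X r (- l) vac)) - vev fockV (X r (- l) (X k l vac)) =
  qint y (l * (k + r)) * vev fockV (X (k + r) 0 vac)
  + (if k + r == 0 then l%:~R else 0).
Proof.
move=> k0 r0; case: l => [[//|l]|//] _.
rewrite (two_point fockV) // [X k l.+1 vac](fock_op_vac fockV) //.
rewrite scale0r (lin0 (XL _ _)) vev0 subr0.
case: eqP => [->|/eqP kr]; first by rewrite mulr0 qint0 mul0r add0r.
by rewrite (fock_op_vac fockV) // vevZ vev_vac mulr1 addr0.
Qed.

(* Both sides have the same commutators with the modes [a j] for [k, r] fixed,
   so that only their vacuum expectation values are to be compared. *)
Lemma fock_op_bracket_neq0 k l r s v : k != 0 -> r != 0 ->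
  X k l (X r s v) - X r s (X k l v) =
  qint y (l * r - s * k) *: X (k + r) (l + s) v
  + (if (k + r == 0) && (l + s == 0) then l%:~R else 0) *: v.
Proof.
move=> k0 r0.
pose L (l s : int) w := X k l (X r s w) - X r s (X k l w).
pose dl (l s : int) : C := if (k + r == 0) && (l + s == 0) then l%:~R else 0.
pose M (l s : int) w := qint y (l * r - s * k) *: X (k + r) (l + s) w + dl l s *: w.
apply/eqP; rewrite -subr_eq0 -/(L l s v) -/(M l s v); apply/eqP.
have LL i j : linear (L i j).
  by apply: linear_fun_sub; apply: linear_fun_comp; apply: XL.
have ML i j : linear (M i j).
  by apply: linear_fun_add; apply: linear_fun_scale => //; apply: XL.
apply: (operators_eq0 (fockV := fockV) (D := fun l s w => L l s w - M l s w)
  (x := fun j => qint y (j * k)) (z := fun j => qint y (j * r))) => [i i'|j i i' w|i i'].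
- exact: linear_fun_sub.
- have -> : a j (L i i' w - M i i' w) = a j (L i i' w) - a j (M i i' w).
    exact: linB.
  have -> : a j (L i i' w) = L i i' (a j w) +
      (qint y (j * k) *: L (i + j) i' w + qint y (j * r) *: L i (i' + j) w).
    rewrite /L (linB (aL j)) !(fock_op_comm fockV) // !(linD (XL _ _)) !(linZ (XL _ _)).
    rewrite !scalerBr !opprD !addrA.
    by rewrite [LHS](ACl (1*4*3*5*2*6)%AC).
  have -> : a j (M i i' w) = M i i' (a j w) +
      (qint y (j * k) *: M (i + j) i' w + qint y (j * r) *: M i (i' + j) w).
    rewrite /M (linD (aL j)) !(linZ (aL j)) !scalerDr !scalerA.
    (* For [k + r = 0] the right-hand side holds a mode, whose commutator with [a j] is scalar; it
       is matched by the difference of the two shifted central terms. *)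
    have [kr|kr] := eqVneq (k + r) 0.
      have rE : r = - k by lia.
      rewrite kr !fock_op0 (fock_comm fockV) scalerDr scalerA -[LHS]addrA -[RHS]addrA.
      congr (_ + _); rewrite [LHS]addrC; congr (_ + _).
      have -> : i + j + i' = i + (i' + j) by lia.
      have -> : (i + j) * r - i' * k = i * r - (i' + j) * k by rewrite rE; ring.
      rewrite [j * r](_ : _ = - (j * k)) ?rE ?mulrN // qintN !mulNr !scaleNr.
      rewrite [RHS](AC (2*2)%AC (1*3*(2*4))%AC) /= subrr add0r -scalerBl; congr (_ *: _).
      rewrite /dl kr eqxx /= -mulrBr.
      have -> : j + (i + i') = i + j + i' by lia.
      have -> : i + (i' + j) = i + j + i' by lia.
      case: eqP => [ij|_]; last by rewrite subrr !mulr0.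
      rewrite -intrB addrAC subrr add0r; congr (qint y _ * _).
      by rewrite ?rE (_ : j = - (i + i')); [ring|lia].
    rewrite (fock_op_comm fockV) // /dl (negPf kr) !(mulr0, scale0r, addr0) /=.
    rewrite scalerDr scalerA; congr (_ + _).
    have -> : i + j + i' = i + i' + j by lia.
    have -> : i + (i' + j) = i + i' + j by lia.
    by rewrite -scalerDl qint_jacobi.
  rewrite !scalerBr !opprD !addrA.
  by rewrite [LHS](ACl (1*6*7*2*3*8*4*5*9)%AC).
- rewrite /L /M !vevB vevD !vevZ vev_vac mulr1; apply/eqP; rewrite subr_eq0.
  apply/eqP; have [ii|ii] := eqVneq (i + i') 0; last first.
    have ii' : i' + i != 0 by rewrite addrC.
    rewrite (vev_two_point_neq0 _ _ ii) (vev_two_point_neq0 _ _ ii').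
    rewrite (vev_fock_op_vac _ _ _ _ ii) mulr0 subrr.
    by rewrite /dl (negPf ii) andbF add0r.
  have -> : i' = - i by lia.
  rewrite /dl subrr eqxx andbT mulNr opprK -mulrDr [r + k]addrC.
  have [i0|i0|->] := ltrgtP i 0.
  (* A negative index is reduced to a positive one by exchanging the two operators. *)
  - have [i1 iE] : exists i1, i = - i1 by exists (- i); rewrite opprK.
    have i10 : 0 < i1 by rewrite -oppr_lt0 -iE.
    rewrite iE opprK -[LHS]opprB vev_bracket_gt0 // [r + k]addrC.
    rewrite mulNr qintN opprD mulNr.
    by case: ifP; rewrite ?oppr0 // mulrNz.
  - exact: vev_bracket_gt0.
  - rewrite mul0r qint0 mul0r add0r oppr0 !(fock_op_vac fockV) // !eqxx.
    rewrite !(linZ (XL _ _)) !(fock_op_vac fockV) // !eqxx !vevZ mulrCA subrr.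
    by rewrite if_same.
Qed.

Lemma fock_op_bracket k l r s v :
  X k l (X r s v) - X r s (X k l v) =
  (y ^ (s * k - l * r) - y ^ (l * r - s * k)) *: X (k + r) (l + s) v
  + (if (k + r == 0) && (l + s == 0) then l%:~R else 0) *: v.
Proof.
rewrite qint_sub.
have [->|k0] := eqVneq k 0; have [->|r0] := eqVneq r 0.
- rewrite addr0 !fock_op0 !mulr0 subrr qint0 scale0r add0r eqxx /=.
  by rewrite (fock_comm fockV) addrAC subrr add0r.
- rewrite !fock_op0 (fock_op_comm fockV) // mulr0 subr0 !add0r addrAC subrr add0r.
  by rewrite (negPf r0) /= scale0r addr0 [s + l]addrC.
- rewrite !fock_op0 (fock_op_comm fockV) // mulr0 sub0r addr0 (negPf k0) /=.
  by rewrite scale0r addr0 opprD addrA subrr sub0r qintN scaleNr.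
- exact: fock_op_bracket_neq0.
Qed.

End FockBracket.

(** * Interpolation in the first index *)

(** Newton's scheme: a new node is matched by adding a multiple of the polynomial that vanishes
    exactly at the earlier nodes. *)
Lemma interpolation (F : fieldType) (I : eqType) (z x : I -> F) (s : seq I) :
  injective z -> exists P : {poly F}, {in s, forall i, P.[z i] = x i}.
Proof.
move=> zI; elim: s => [|i s [P PE]]; first by exists 0.
have [si|si] := boolP (i \in s).
  by exists P => j; rewrite in_cons => /orP[/eqP->|]; apply: PE.
pose Q := \prod_(w <- [seq z j | j <- s]) ('X - w%:P).
have Qi : Q.[z i] != 0.
  by rewrite -rootE root_prod_XsubC mem_map.
exists (P + ((x i - P.[z i]) / Q.[z i]) *: Q) => j.
rewrite in_cons hornerD hornerZ => /orP[/eqP->|sj].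
  by rewrite mulfVK // addrC subrK.
have /rootP -> : root Q (z j) by rewrite root_prod_XsubC map_f.
by rewrite mulr0 addr0 PE.
Qed.

Section LaurentFamilies.
Variables (C : numFieldType) (V : lmodType C) (y : C).
Hypothesis y0 : y != 0.

(* [F k], for [k != 0], is a Laurent polynomial in [y ^ k]; its value and its
   derivative with respect to [k] at [k = 0] are [A] and [B * log y]. *)
Definition laurent (F : int -> V) (A B : V) : Prop :=
  exists s : seq (int * V),
    [/\ forall k, k != 0 -> F k = \sum_(p <- s) y ^ (k * p.1) *: p.2,
        A = \sum_(p <- s) p.2 & B = \sum_(p <- s) p.1%:~R *: p.2].

Lemma eq_laurent F G A B :
  (forall k, k != 0 -> F k = G k) -> laurent F A B -> laurent G A B.
Proof. by move=> FG [s [FE AE BE]]; exists s; split=> // k k0; rewrite -FG ?FE. Qed.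

Lemma laurent0 : laurent (fun=> 0) 0 0.
Proof. by exists [::]; split=> [k _||]; rewrite big_nil. Qed.

Lemma laurent_cst v : laurent (fun=> v) v 0.
Proof.
exists [:: (0, v)]; split=> [k _||]; rewrite big_seq1 //= ?mulr0 ?scale1r //.
by rewrite scale0r.
Qed.

Lemma laurent_linear x F G A B A' B' : laurent F A B -> laurent G A' B' ->
  laurent (fun k => x *: F k + G k) (x *: A + A') (x *: B + B').
Proof.
move=> [s [FE -> ->]] [t [GE -> ->]].
exists ([seq (p.1, x *: p.2) | p <- s] ++ t).
split=> [k k0||]; rewrite big_cat big_map /= ?FE ?GE // scaler_sumr //;
  congr (_ + _); apply: eq_bigr => p _; by rewrite !scalerA mulrC.
Qed.

Lemma laurentD F G A B A' B' : laurent F A B -> laurent G A' B' ->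
  laurent (fun k => F k + G k) (A + A') (B + B').
Proof.
move=> FL GL; have := laurent_linear 1 FL GL; rewrite !scale1r.
by apply: eq_laurent => k _; rewrite scale1r.
Qed.

Lemma laurentZ x F A B : laurent F A B ->
  laurent (fun k => x *: F k) (x *: A) (x *: B).
Proof.
move=> FL; have := laurent_linear x FL laurent0; rewrite !addr0.
by apply: eq_laurent => k _; rewrite addr0.
Qed.

Lemma laurent_sum (I : Type) (r : seq I) (F : I -> int -> V) (A B : I -> V) :
  (forall i, laurent (F i) (A i) (B i)) ->
  laurent (fun k => \sum_(i <- r) F i k) (\sum_(i <- r) A i) (\sum_(i <- r) B i).
Proof.
move=> FL; elim: r => [|i r IHr].
  by rewrite !big_nil; apply: eq_laurent laurent0 => k _; rewrite big_nil.
rewrite !big_cons; apply: eq_laurent (laurentD (FL i) IHr) => k _.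
by rewrite big_cons.
Qed.

Lemma laurent_map (T : V -> V) F A B : linear T -> laurent F A B ->
  laurent (fun k => T (F k)) (T A) (T B).
Proof.
move=> TL [s [FE -> ->]]; exists [seq (p.1, T p.2) | p <- s].
split=> [k k0||]; rewrite big_map /= ?FE // (lin_sum TL) //.
  by apply: eq_bigr => p _; rewrite (linZ TL).
by apply: eq_bigr => p _; rewrite (linZ TL).
Qed.

Lemma laurent_shift (e : int) F A B : laurent F A B ->
  laurent (fun k => y ^ (e * k) *: F k) A (e%:~R *: A + B).
Proof.
move=> [s [FE -> ->]]; exists [seq (e + p.1, p.2) | p <- s].
split=> [k k0||]; rewrite big_map //= ?FE // scaler_sumr.
  by apply: eq_bigr => p _; rewrite scalerA -expfzDr // [k * (_ + _)]mulrDr [k * e]mulrC.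
rewrite -big_split; apply: eq_bigr => p _ /=.
by rewrite intrD scalerDl.
Qed.

(** [qint y (e * k)] vanishes at $k=0$ with derivative $-2e\log y$, so only the value [A] enters the
    new derivative. *)
Lemma laurent_qint (e : int) F A B : laurent F A B ->
  laurent (fun k => qint y (e * k) *: F k) 0 (- (2 * e)%:~R *: A).
Proof.
move=> FL; have := laurent_linear (- 1) (laurent_shift e FL) (laurent_shift (- e) FL).
rewrite !scaleN1r addNr opprD -!scaleNr -[- B]scaleN1r addrACA scaleN1r addNr addr0.
rewrite -scalerDl; have -> : - e%:~R + (- e)%:~R = - (2 * e)%:~R :> C.
  by rewrite -!mulrNz -intrD; congr (_%:~R); lia.
by apply: eq_laurent => k _; rewrite scaleN1r addrC -scalerBl mulNr.
Qed.

(* Lagrange interpolation recovers the derivative at [k = 0] from the values at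
   the [k] in an arithmetic progression. *)
Lemma laurent_derivative (K : V -> Prop) F A B (k0 n : nat) :
    (forall k : int, k != 0 -> y ^ k != 1) ->
    K 0 -> (forall x v w, K v -> K w -> K (x *: v + w)) ->
    (0 < k0)%N -> (0 < n)%N -> laurent F A B ->
    (forall t : nat, K (F (k0 + n * t)%N)) ->
  K B.
Proof.
move=> y_nroot K0 KL k0_gt0 n_gt0 [s [FE _ ->]] KF.
have zI : injective (fun e : int => y ^ (n%:Z * e)).
  move=> e f /= ef; apply/eqP; rewrite -subr_eq0 -[_ == 0]negbK; apply/negP => ef0.
  have /eqP[] : y ^ (n%:Z * (e - f)) != 1.
    by apply: y_nroot; rewrite mulf_neq0 //; lia.
  by rewrite mulrBr expfzDr // ef -expfzDr // subrr.
(* [P] takes the value $e\,y^{-k_0e}$ at $y^{ne}$. Hence combining the $F(k_0+nt)$ with the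
   coefficients of [P] replaces each $y^{ke}$ by $e$. *)
have [P PE] := interpolation (fun e : int => e%:~R * y ^ (- (k0%:Z * e)))
  [seq p.1 | p <- s] zI.
suff -> : \sum_(p <- s) p.1%:~R *: p.2 = \sum_(t < size P) P`_t *: F (k0 + n * t)%N.
  have KD v w : K v -> K w -> K (v + w) by rewrite -[v in v + w]scale1r; apply: KL.
  by apply: big_ind => // t _; rewrite -[_ *: _]addr0; apply: KL.
have E (t : nat) : P`_t *: F (k0 + n * t)%N =
    \sum_(p <- s) (y ^ (k0%:Z * p.1) * (P`_t * (y ^ (n%:Z * p.1)) ^+ t)) *: p.2.
  rewrite FE; last by lia.
  rewrite scaler_sumr; apply: eq_bigr => p _; rewrite scalerA; congr (_ *: _).
  rewrite mulrCA; congr (_ * _); rewrite exprnP exprz_exp -expfzDr //.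
  by congr (_ ^ _); rewrite PoszD PoszM; ring.
under [RHS]eq_bigr do rewrite E.
rewrite exchange_big /= big_seq [RHS]big_seq; apply: eq_bigr => p ps.
rewrite -scaler_suml -mulr_sumr -horner_coef PE ?map_f //.
by rewrite mulrCA -expfzDr // subrr mulr1.
Qed.

End LaurentFamilies.

(** * Dependence of the Fock operators on the first index *)

Section FockLaurent.
Variables (C : numFieldType) (V : lmodType C) (a : int -> V -> V).
Variables (alpha : C) (vac : V).
Hypothesis fockV : is_heisenberg_fock a alpha vac.
Variables (y u : C).
Hypotheses (y0 : y != 0) (u0 : u != 0).
Hypothesis y_nroot : forall k : int, k != 0 -> y ^ k != 1.

Let aL := fock_linear fockV.
Notation X := (fock_op a y u).
Let XL k l : linear (X k l) := fock_op_linear fockV y u k l.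

Let W (l : int) v (k : int) := (u ^ k / (1 - y ^ (2 * k)))^-1 *: X k l v.

Let W_comm (l j : int) v (k : int) : k != 0 ->
  W l (a j v) k = a j (W l v k) - qint y (j * k) *: W (l + j) v k.
Proof.
move=> k0; rewrite /W (linZ (aL j)) (fock_op_comm fockV) // scalerDr.
by rewrite !scalerA [qint _ _ * _]mulrC addrK.
Qed.

Let W_vac (l k : int) : k != 0 -> 0 <= l -> W l vac k = if l == 0 then vac else 0.
Proof.
move=> k0 l0; rewrite /W (fock_op_vac fockV) //; case: ifP => _; last first.
  by rewrite scale0r scaler0.
rewrite scalerA mulVf ?scale1r // mulf_neq0 ?invr_eq0 ?expfz_neq0 //.
by apply: (sub1_expz_neq0 y_nroot); lia.
Qed.

Let W_laurent_vac (l : nat) :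
  laurent y (W (- l%:Z) vac) (if l == 0%N then vac else 0)
    (if l == 0%N then 0 else - 2 *: a (- l%:Z) vac).
Proof.
elim/ltn_ind: l => -[|l] IHl.
  by apply: eq_laurent (laurent_cst y vac) => k k0; rewrite W_vac.
have l0 : l.+1%:R != 0 :> C by rewrite pnatr_eq0.
have IHm (m : 'I_l.+1) := laurent_qint y0 m.+1 (laurent_map (aL (- m.+1%:Z))
  (IHl (l.+1 - m.+1)%N ltac:(by rewrite subSS ltnS leq_subr))).
have := laurentZ l.+1%:R^-1 (laurent_sum (index_enum _) IHm).
(* Only the last summand, with inner index 0, has a nonzero value at $k=0$, so it alone contributes
   to the derivative. *)
rewrite big1 // scaler0 big_ord_recr /= subnn /= big1 => [|m _]; last first.
  by rewrite ifF ?(lin0 (aL _)) ?scaler0 //; have := ltn_ord m; lia.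
rewrite add0r scalerA.
have -> : l.+1%:R^-1 * - (2 * l.+1%:Z)%:~R = - 2 :> C.
  by rewrite intrM mulrN mulrCA mulVf // mulr1.
apply: eq_laurent => k k0; apply: (scalerI l0).
rewrite scalerA divff // scale1r /W [RHS]scalerA [l.+1%:R * _]mulrC -[RHS]scalerA.
rewrite (fock_op_vac_recursion fockV) // scaler_sumr; apply: eq_bigr => m _.
by rewrite (linZ (aL _)) !scalerA mulrC.
Qed.

(** To first order in $k$ the normally ordered exponential is $1-2k\log y\sum_{j\ne0}a_jz^{-j}$; the
    coefficients of $z^{-l}$ give the two entries. *)
Lemma fock_op_laurent l v :
  laurent y (fun k => (u ^ k / (1 - y ^ (2 * k)))^-1 *: X k l v)
    (if l == 0 then v else 0) (if l == 0 then 0 else - 2 *: a l v).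
Proof.
elim/(fock_ind fockV): v l => [l|x v w Lv Lw l|j v Lv l].
- have [l0|l0] := ltP l 0.
    have lE : l = - `|l|%N%:Z by lia.
    by have := W_laurent_vac `|l|; rewrite -lE; have -> : (`|l|%N == 0%N) = (l == 0) by lia.
  apply: (@eq_laurent _ _ _ (fun=> if l == 0 then vac else 0)) => [k k0|].
    exact/esym/W_vac.
  case: (eqVneq l 0) => [_|l1]; first exact: laurent_cst.
  rewrite (fock_vac_gt0 fockV) ?scaler0; first exact: laurent0.
  by rewrite lt_neqAle eq_sym l1.
- have := laurent_linear x (Lv l) (Lw l).
  have -> : x *: (if l == 0 then v else 0) + (if l == 0 then w else 0) =
      (if l == 0 then x *: v + w else 0) by case: ifP; rewrite ?scaler0 ?addr0.
  have -> : x *: (if l == 0 then 0 else - 2 *: a l v) +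
        (if l == 0 then 0 else - 2 *: a l w) =
      (if l == 0 then 0 else - 2 *: a l (x *: v + w)).
    by case: ifP; rewrite ?scaler0 ?addr0 // aL scalerDr !scalerA mulrC.
  by apply: eq_laurent => k _; rewrite XL scalerDr !scalerA mulrC.
- have Lj := laurent_qint y0 j (Lv (l + j)).
  have := laurent_linear (- 1) Lj (laurent_map (aL j) (Lv l)).
  rewrite scaler0 add0r => H.
  have EA : a j (if l == 0 then v else 0) = if l == 0 then a j v else 0.
    by case: ifP => // _; rewrite (lin0 (aL j)).
  have EB : -1 *: (- (2 * j)%:~R *: (if l + j == 0 then v else 0))
     + a j (if l == 0 then 0 else - 2 *: a l v) =
     (if l == 0 then 0 else - 2 *: a l (a j v)).
    rewrite scalerA mulN1r opprK.
    have [->|l0] := eqVneq l 0.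
      rewrite add0r (lin0 (aL j)) addr0; case: eqP => [->|]; rewrite ?scaler0 //.
      by rewrite mulr0 scale0r.
    rewrite (linZ (aL j)) (fock_comm fockV j l) scalerDr [j + l]addrC.
    case: eqP => [lj|_]; last by rewrite !scaler0 scale0r scaler0 add0r addr0.
    by rewrite addrCA scalerA -scalerDl intrM mulNr subrr scale0r addr0.
  rewrite EA EB in H; apply: eq_laurent H => k k0.
  by rewrite -/(W l (a j v) k) W_comm // scaleN1r addrC.
Qed.

Lemma fock_op_progression_closed (K : V -> Prop) (k0 n : nat) l v :
    K 0 -> (forall x v w, K v -> K w -> K (x *: v + w)) ->
    (0 < k0)%N -> (0 < n)%N -> l != 0 ->
    (forall t : nat, K (X (k0 + n * t)%N l v)) ->
  K (a l v).
Proof.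
move=> K0 KL k0_gt0 n_gt0 l0 KX.
have KZ x w : K w -> K (x *: w).
  by move=> Kw; rewrite -[_ *: _]addr0; apply: KL.
have := fock_op_laurent l v; rewrite !(negPf l0) => FL.
have /(KZ (- 2)^-1) := laurent_derivative y0 y_nroot K0 KL k0_gt0 n_gt0 FL
  (fun t => KZ _ _ (KX t)).
by rewrite scalerA mulVf ?scale1r // oppr_eq0 pnatr_eq0.
Qed.

End FockLaurent.

(** * Highest weight modules *)

Section HighestWeight.
Variables (C : numFieldType) (V : lmodType C) (a : int -> V -> V).
Variables (alpha : C) (vac : V).
Hypothesis fockV : is_heisenberg_fock a alpha vac.
Variables (I : Type) (deg : I -> int).

(** Since the Fock module is irreducible under its modes, this condition forces every stable
    subspace to be zero or everything. *)
Definition irreducible_family (A : I -> V -> V) : Prop :=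
  forall K : V -> Prop, K 0 -> (forall x v w, K v -> K w -> K (x *: v + w)) ->
    (forall i v, K v -> K (A i v)) -> forall l v, l != 0 -> K v -> K (a l v).

Variables A B : I -> V -> V.
Hypotheses (AL : forall i, linear (A i)) (BL : forall i, linear (B i)).
Hypothesis AB_bracket : forall i j, exists c d k,
  (forall v, A i (A j v) = A j (A i v) + (c *: A k v + d *: v)) /\
  (forall v, B i (B j v) = B j (B i v) + (c *: B k v + d *: v)).
Hypothesis AB_vac : forall i, 0 <= deg i ->
  exists e, A i vac = e *: vac /\ B i vac = e *: vac.
Hypothesis A_vev : forall i v, deg i < 0 -> vev fockV (A i v) = 0.
Hypothesis B_vev : forall i v, deg i < 0 -> vev fockV (B i v) = 0.
Hypotheses (A_irr : irreducible_family A) (B_irr : irreducible_family B).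

(* The submodule of [V * V] generated by [(vac, vac)] turns out to be the graph
   of the isomorphism. *)
Inductive hw_graph : V -> V -> Prop :=
  | hw_vac : hw_graph vac vac
  | hw_linear x v v' w w' : hw_graph v v' -> hw_graph w w' ->
      hw_graph (x *: v + w) (x *: v' + w')
  | hw_lower i v v' : deg i < 0 -> hw_graph v v' -> hw_graph (A i v) (B i v').

Lemma hw_graph0 : hw_graph 0 0.
Proof.
by have := hw_linear (- 1) hw_vac hw_vac; rewrite scaleN1r addNr.
Qed.

Lemma hw_graphZ x v v' : hw_graph v v' -> hw_graph (x *: v) (x *: v').
Proof. by move=> /(hw_linear x)/(_ hw_graph0); rewrite !addr0. Qed.

(** An operator of nonnegative degree is commuted to the right past those of negative degree until
    it reaches [vac], where both families act by the same scalar. *)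
Lemma hw_graph_stable i v v' : hw_graph v v' -> hw_graph (A i v) (B i v').
Proof.
move=> vv'; elim: vv' i => [|x {}v {}v' w w' _ IHv _ IHw|j {}v {}v' j0 vv' IHv] i.
- have [i0|i0] := leP 0 (deg i); last exact: (hw_lower i0 hw_vac).
  by have [e [-> ->]] := AB_vac i0; apply/hw_graphZ/hw_vac.
- by rewrite AL BL; apply: hw_linear.
- have [c [d [k [-> ->]]]] := AB_bracket i j.
  rewrite -[A j _]scale1r -[B j _]scale1r; apply: hw_linear.
    exact: hw_lower.
  by apply: hw_linear => //; apply: hw_graphZ.
Qed.

Lemma hw_graph_vev v v' : hw_graph v v' -> vev fockV v = vev fockV v'.
Proof.
elim=> [//|x {}v {}v' w w' _ vv' _ ww'|i {}v {}v' i0 _ _].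
  by rewrite !vev_linear vv' ww'.
by rewrite A_vev ?B_vev.
Qed.

(** The vectors paired with 0 form a stable subspace on which the functional vanishes, so
    [fock_nondegenerate] applies. *)
Lemma hw_graph_inj v : hw_graph v 0 -> v = 0.
Proof.
have K0 := hw_graph0; pose K v := hw_graph v 0.
apply: (fock_nondegenerate (fockV := fockV) (K := K)) => [w /hw_graph_vev ->|j w j0].
  exact: vev0.
have KL x u u' : K u -> K u' -> K (x *: u + u').
  by move=> Ku Ku'; have := hw_linear x Ku Ku'; rewrite scaler0 addr0.
have KI i u : K u -> K (A i u).
  by move=> Ku; have := hw_graph_stable i Ku; rewrite (lin0 (BL i)).
by apply: (A_irr K0 KL KI); rewrite gt_eqF.
Qed.

Lemma hw_graph_fun v' : hw_graph 0 v' -> v' = 0.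
Proof.
have K0 := hw_graph0; pose K v' := hw_graph 0 v'.
apply: (fock_nondegenerate (fockV := fockV) (K := K)) => [w /hw_graph_vev <-|j w j0].
  exact: vev0.
have KL x u u' : K u -> K u' -> K (x *: u + u').
  by move=> Ku Ku'; have := hw_linear x Ku Ku'; rewrite scaler0 addr0.
have KI i u : K u -> K (B i u).
  by move=> Ku; have := hw_graph_stable i Ku; rewrite (lin0 (AL i)).
by apply: (B_irr K0 KL KI); rewrite gt_eqF.
Qed.

Lemma hw_graph_total v : exists v', hw_graph v v'.
Proof.
pose K v := exists v', hw_graph v v'.
have KL x u w : K u -> K w -> K (x *: u + w).
  by move=> [u' uu'] [w' ww']; exists (x *: u' + w'); apply: hw_linear.
elim/(fock_creation_ind fockV): v => [|x v w|l v l0].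
- by exists vac; apply: hw_vac.
- exact: KL.
- have K0 : K 0 by exists 0; apply: hw_graph0.
  have KI i u : K u -> K (A i u).
    by move=> [u' uu']; exists (B i u'); apply: hw_graph_stable.
  by apply: (A_irr K0 KL KI); rewrite lt_eqF.
Qed.

Lemma hw_graph_onto v' : exists v, hw_graph v v'.
Proof.
pose K v' := exists v, hw_graph v v'.
have KL x u w : K u -> K w -> K (x *: u + w).
  by move=> [u' uu'] [w' ww']; exists (x *: u' + w'); apply: hw_linear.
elim/(fock_creation_ind fockV): v' => [|x v w|l v l0].
- by exists vac; apply: hw_vac.
- exact: KL.
- have K0 : K 0 by exists 0; apply: hw_graph0.
  have KI i u : K u -> K (B i u).
    by move=> [u' uu']; exists (A i u'); apply: hw_graph_stable.
  by apply: (B_irr K0 KL KI); rewrite lt_eqF.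
Qed.

Theorem hw_isomorphism : exists f : V -> V,
  [/\ linear f, bijective f & forall i v, f (A i v) = B i (f v)].
Proof.
pose f v := sval (cid (hw_graph_total v)).
pose g v := sval (cid (hw_graph_onto v)).
have fP v : hw_graph v (f v) := svalP (cid (hw_graph_total v)).
have gP v : hw_graph (g v) v := svalP (cid (hw_graph_onto v)).
have graphB v v' w w' : hw_graph v v' -> hw_graph w w' -> hw_graph (v - w) (v' - w').
  by move=> vv' ww'; have := hw_linear (- 1) ww' vv'; rewrite !scaleN1r ![- _ + _]addrC.
have fE v v' : hw_graph v v' -> f v = v'.
  move=> vv'; apply/eqP; rewrite -subr_eq0; apply/eqP/hw_graph_fun.
  by rewrite -(subrr v); apply: graphB.
exists f; split=> [x v w||i v].
- by apply: fE; apply: hw_linear.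
- exists g => [v|v]; last exact: fE.
  apply/eqP; rewrite -subr_eq0; apply/eqP/hw_graph_inj.
  by rewrite -(subrr (f v)); apply: graphB.
- by apply: fE; apply: hw_graph_stable.
Qed.

End HighestWeight.

(** * Actions of Diff_q *)

Section DiffqLinear.
Variable C : fieldType.

Lemma fgscaleU (c k : C) (i : diffq_index) :
  c *: (<< k *g i >> : diffq C) = << (c * k) *g i >>.
Proof. by apply/eqP/freeg_eqP => j; rewrite coeffZ !coeffU mulrA. Qed.

Lemma freegU_basis (k : C) (i : diffq_index) : << k *g i >> = k *: Defs.basis C i.
Proof. by rewrite fgscaleU mulr1. Qed.

Lemma fglift_linear (W : lmodType C) (f : diffq_index -> W) :
  linear (fglift f : diffq C -> W).
Proof.
have fB : additive (fglift f : diffq C -> W) := lift_is_additive f.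
have f0 : fglift f (0 : diffq C) = 0 by rewrite -(subrr 0) fB subrr.
have fD (x z : diffq C) : fglift f (x + z) = fglift f x + fglift f z.
  by rewrite -[z in LHS]opprK fB -[- z]sub0r fB f0 sub0r opprK.
move=> c x z; rewrite fD; congr (_ + _).
elim/freeg_ind_dom0: x => [|k i x _ _ IHx]; first by rewrite scaler0 f0 scaler0.
by rewrite scalerDr !fD IHx scalerDr fgscaleU !liftU scalerA.
Qed.

Lemma diffq_ind (P : diffq C -> Prop) :
    (forall c x z, P x -> P z -> P (c *: x + z)) ->
    (forall k l, (k, l) != (0, 0) -> P (dE C k l)) -> P (dc C) -> P (dc' C) ->
  forall x, P x.
Proof.
move=> PL PE Pc Pc'; have P0 : P 0.
  by rewrite -(subrr (dc C)) addrC -scaleN1r; apply: PL.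
elim/freeg_ind_dom0 => [//|k i x _ _ Px]; rewrite freegU_basis; apply: PL => //.
case: i => [[[r s] rs]||] //; have := PE r s rs.
by rewrite /dE insubT.
Qed.

Lemma fglift_dE (W : lmodType C) (f : diffq_index -> W) k l
    (kl : (k, l) != (0, 0)) : fglift f (dE C k l) = f (iE (exist _ (k, l) kl)).
Proof. by rewrite /dE insubT fglift_basis. Qed.

Variable qpow : rat -> C.

Lemma bracket_linear_l z : linear (bracket qpow ^~ z).
Proof. by move=> c x x'; rewrite /bracket fglift_linear. Qed.

Lemma bracket_linear_r x : linear (bracket qpow x).
Proof.
move=> c z z'; elim/diffq_ind: x => [d x x' Px Px'|k l kl||].
- rewrite !bracket_linear_l Px Px' scalerDr scalerDr !scalerA mulrC.
  by rewrite addrACA.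
- by rewrite /bracket !fglift_dE fglift_linear.
- by rewrite /bracket !fglift_basis fglift_linear.
- by rewrite /bracket !fglift_basis fglift_linear.
Qed.

(** The relation is bilinear and both sides vanish on central elements, so pairs of basis elements
    [E_{k,l}] suffice. *)
Lemma diffq_actionP (V : lmodType C) (rho : diffq C -> V -> V) (x0 x1 : C) :
    (forall v, linear (fun x => rho x v)) -> (forall x, linear (rho x)) ->
    (forall v, rho (dc C) v = x0 *: v) -> (forall v, rho (dc' C) v = x1 *: v) ->
    (forall k l r s v, (k, l) != (0, 0) -> (r, s) != (0, 0) ->
      rho (dE C k l) (rho (dE C r s) v) - rho (dE C r s) (rho (dE C k l) v) =
      rho (bracket qpow (dE C k l) (dE C r s)) v) ->
  is_diffq_action qpow rho.
Proof.
move=> rhoL rhoV rc rc' rE; split=> // x z v.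
have brL := bracket_linear_l; have brR := bracket_linear_r.
have rho0 w : rho 0 w = 0 := lin0 (rhoL w).
elim/diffq_ind: x => [d x x' Px Px'|k l kl||].
- rewrite brL !rhoL (rhoV z) Px Px' scalerBr opprD.
  by rewrite addrACA.
- elim/diffq_ind: z => [d z z' Pz Pz'|r s rs||].
  + rewrite brR !rhoL (rhoV (dE _ _ _)) Pz Pz' scalerBr opprD.
    by rewrite addrACA.
  + by rewrite rE.
  + rewrite !rc (linZ (rhoV _)) subrr -(rho0 v); congr rho.
    by rewrite /bracket fglift_dE fglift_basis.
  + rewrite !rc' (linZ (rhoV _)) subrr -(rho0 v); congr rho.
    by rewrite /bracket fglift_dE fglift_basis.
- rewrite !rc (linZ (rhoV _)) subrr -(rho0 v); congr rho; rewrite /bracket.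
  rewrite fglift_basis /=.
  elim/diffq_ind: z => [d z z' Pz Pz'|r s rs||]; rewrite ?fglift_basis ?fglift_dE //.
  by rewrite fglift_linear Pz Pz' scaler0 addr0.
- rewrite !rc' (linZ (rhoV _)) subrr -(rho0 v); congr rho; rewrite /bracket.
  rewrite fglift_basis /=.
  elim/diffq_ind: z => [d z z' Pz Pz'|r s rs||]; rewrite ?fglift_basis ?fglift_dE //.
  by rewrite fglift_linear Pz Pz' scaler0 addr0.
Qed.

Lemma sigma_aut_linear sigma : linear (@sigma_aut C sigma).
Proof. exact: fglift_linear. Qed.

Lemma sigma_aut_dE sigma k l : (k, l) != (0, 0) ->
  sigma_aut sigma (dE C k l) =
  dE C (sigma 0 0 * k + sigma 0 1 * l) (sigma 1 0 * k + sigma 1 1 * l).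
Proof. by move=> kl; rewrite /sigma_aut fglift_dE. Qed.

End DiffqLinear.

(** * Fractional powers of $q$ *)

Section FractionalPowers.
Variables (C : numFieldType) (q : C) (qpow : rat -> C).
Hypotheses (q0 : q != 0) (qpowP : fractional_powers q qpow).

Lemma qpow0 : qpow 0 = 1.
Proof.
case: qpowP => q1 qD; apply: (mulfI q0).
by rewrite -[in LHS]q1 -qD addr0 mulr1.
Qed.

Lemma qpow_neq0 r : qpow r != 0.
Proof.
case: qpowP => q1 qD; apply/eqP => qr.
have := qpow0; rewrite -(subrr r) qD qr mul0r => /eqP.
by rewrite eq_sym oner_eq0.
Qed.

Lemma qpowN r : qpow (- r) = (qpow r)^-1.
Proof.
case: qpowP => q1 qD; apply: (mulfI (qpow_neq0 r)).
by rewrite -qD subrr qpow0 divff ?qpow_neq0.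
Qed.

Lemma qpow_int (k : int) r : qpow (k%:~R * r) = qpow r ^ k.
Proof.
have qpow_nat (n : nat) : qpow (n%:R * r) = qpow r ^+ n.
  elim: n => [|n IHn]; first by rewrite mul0r qpow0.
  by rewrite mulrSr mulrDl mul1r (proj2 qpowP) IHn exprSr.
case: k => n; first by rewrite -exprnP -qpow_nat.
by rewrite NegzE mulrNz mulNr qpowN -exprnN -qpow_nat.
Qed.

Lemma qpow_root (n : nat) : (0 < n)%N -> qpow (1 / n%:R) ^+ n = q.
Proof.
move=> n0; rewrite exprnP -qpow_int mulrC divfK ?(proj1 qpowP) //.
by rewrite pnatr_eq0 -lt0n.
Qed.

Hypothesis q_nroot : not_root_of_unity q.

Lemma qpow_nroot (n : nat) (k : int) : (0 < n)%N -> k != 0 ->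
  qpow (1 / n%:R) ^ k != 1.
Proof.
move=> n0 k0; have H (m : nat) : (0 < m)%N -> qpow (1 / n%:R) ^+ m != 1.
  move=> m0; apply: contra (q_nroot m0) => /eqP E.
  by rewrite -(qpow_root n0) -exprM mulnC exprM E expr1n.
case: k k0 => m m0; first by rewrite -exprnP; apply: H; lia.
by rewrite NegzE -exprnN invr_eq1; apply: H.
Qed.

Lemma Ecoef_qint (n : nat) (k : int) : (0 < n)%N ->
  Ecoef qpow n k = qint (qpow (1 / (2 * n)%:R)) k / k%:~R.
Proof.
move=> n0; rewrite /Ecoef /qint -!qpow_int natrM mulrNz.
by rewrite ![_ * (1 / _)]mulrA !mulr1.
Qed.

Lemma Fcoef_qint (n : nat) (k : int) : (0 < n)%N ->
  Fcoef qpow n k = qint (qpow (1 / (2 * n)%:R)) (- k) / k%:~R.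
Proof.
move=> n0; rewrite /Fcoef /qint opprK -!qpow_int natrM mulrNz.
by rewrite ![_ * (1 / _)]mulrA !mulr1.
Qed.

End FractionalPowers.

(** * Twisted and Fock modules *)

Lemma zeta_expn (R : realType) (n m : nat) :
  zeta R n ^+ m = Complex (cos (m%:R * (2 * pi / n%:R))) (sin (m%:R * (2 * pi / n%:R))).
Proof.
rewrite /zeta; move: (2 * pi / n%:R) => t.
elim: m => [|m IHm]; first by rewrite mul0r cos0 sin0.
rewrite exprS IHm [m.+1%:R]mulrSr mulrDl mul1r cosD sinD.
by apply/eqP; rewrite eq_complex /=; apply/andP; split; apply/eqP; ring.
Qed.

Lemma zeta_root (R : realType) (n : nat) : (0 < n)%N -> zeta R n ^+ n = 1.
Proof.
move=> n0; rewrite zeta_expn mulrC divfK ?pnatr_eq0 -?lt0n //.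
by rewrite mulr_natl cos2pi sin2pi.
Qed.

(** * The action through the Fock module of $\mathfrak{Diff}_{q^{1/n}}$ *)

Section FockAction.
Variables (C : numFieldType) (q : C) (qpow : rat -> C).
Hypotheses (q0 : q != 0) (qpowP : fractional_powers q qpow).
Hypothesis q_nroot : not_root_of_unity q.
Variables (V : lmodType C) (a : int -> V -> V) (alpha : C) (vac : V).
Hypothesis fockV : is_heisenberg_fock a alpha vac.
Variables (n : nat) (n' : int) (ur : C).
Hypotheses (n_gt0 : (0 < n)%N) (ur0 : ur != 0).

Let y := qpow (1 / (2 * n)%:R).
Let y0 : y != 0 := qpow_neq0 q0 qpowP _.
Let n2_gt0 : (0 < 2 * n)%N. Proof. by rewrite muln_gt0. Qed.
Let y_nroot k : k != 0 -> y ^ k != 1 := qpow_nroot q0 qpowP q_nroot n2_gt0.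

(* For [n = 1] and [n' = 0] this is the Fock module; in general E_{k,l} of
   Diff_q acts as E_{k, n l + n' k} of Diff_{q^{1/n}}. *)
Definition twisted_op (k l : int) : V -> V := fock_op a y ur k (n%:Z * l + n' * k).

Definition twisted_index (i : diffq_index) (v : V) : V :=
  match i with
  | iE p => twisted_op (\val p).1 (\val p).2 v
  | ic => n%:R *: v
  | ic' => n'%:~R *: v
  end.

Definition twisted_action (x : diffq C) (v : V) : V :=
  fglift (fun i => twisted_index i v) x.

Lemma twisted_action_dE k l v : (k, l) != (0, 0) ->
  twisted_action (dE C k l) v = twisted_op k l v.
Proof. by move=> kl; rewrite /twisted_action fglift_dE. Qed.

Lemma qpow_half (k : int) : qpow (k%:~R / 2) = y ^ (n%:Z * k).
Proof.
rewrite -(qpow_int q0 qpowP); congr qpow; rewrite intrM natrM.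
have nn : n%:R != 0 :> rat by rewrite pnatr_eq0 -lt0n.
by field.
Qed.

(** The index change multiplies $sk-lr$ by $n$, which is absorbed in $y^n=q^{1/2}$; the central term
    $nl+n'k$ accounts for the levels of [c] and [c']. *)
Lemma twisted_op_bracket k l r s v :
  twisted_op k l (twisted_op r s v) - twisted_op r s (twisted_op k l v) =
  (qpow ((s * k - l * r)%:~R / 2) - qpow ((l * r - s * k)%:~R / 2))
    *: twisted_op (k + r) (l + s) v
  + (if (k + r == 0) && (l + s == 0) then n'%:~R * k%:~R + n%:R * l%:~R else 0) *: v.
Proof.
rewrite /twisted_op (fock_op_bracket fockV) // !qpow_half.
congr (_ *: _ + _ *: _).
- by congr (y ^ _ - y ^ _); ring.
- by congr fock_op; ring.
- case: eqP => [kr|//] /=.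
  have -> : n%:Z * l + n' * k + (n%:Z * s + n' * r) = n%:Z * (l + s) + n' * (k + r).
    by ring.
  rewrite kr mulr0 addr0 mulf_eq0; have -> : (n%:Z == 0) = false by lia.
  by case: (l + s == 0) => //=; rewrite intrD !intrM addrC.
Qed.

Lemma twisted_action_is_action : is_diffq_action qpow twisted_action.
Proof.
apply: (diffq_actionP (x0 := n%:R) (x1 := n'%:~R)) => [v|x x' v w|v|v|k l r s v kl rs].
- exact: fglift_linear.
- elim/diffq_ind: x => [c x z Px Pz|k l kl||].
  + rewrite /twisted_action !fglift_linear -/(twisted_action _ _) in Px Pz *.
    rewrite Px Pz !scalerDr !scalerA [c * x']mulrC; exact: addrACA.
  + by rewrite !twisted_action_dE // /twisted_op (fock_op_linear fockV).
  + by rewrite /twisted_action !fglift_basis /= scalerDr !scalerA mulrC.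
  + by rewrite /twisted_action !fglift_basis /= scalerDr !scalerA mulrC.
- by rewrite /twisted_action fglift_basis.
- by rewrite /twisted_action fglift_basis.
- rewrite !twisted_action_dE // twisted_op_bracket bracketE //.
  rewrite /twisted_action.
  have fL := @fglift_linear C V (twisted_index^~ v).
  rewrite fL (linZ fL) (linD fL) !(linZ fL) !fglift_basis /= -/(twisted_action _ _).
  congr (_ + _).
    (* At the index (0, 0), [dE] is 0 whereas [twisted_op] is [a 0]; the structure constant vanishes
       there. *)
    have [E|kl'] := eqVneq (k + r, l + s) (0, 0); last by rewrite twisted_action_dE.
    case: E => kr ls; have -> : s * k - l * r = l * r - s * k.
      have -> : r = - k by lia.
      have -> : s = - l by lia.
      by ring.
    by rewrite subrr !scale0r.
  rewrite !addr_eq0; case: ifP => _; last by rewrite !scale0r.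
  by rewrite scale1r !scalerA -scalerDl [k%:~R * _]mulrC [l%:~R * _]mulrC.
Qed.

Lemma qpow_half_sub_neq0 (j : int) :
  j != 0 -> qpow (j%:~R / 2) - qpow ((- j)%:~R / 2) != 0.
Proof.
move=> j0; rewrite !qpow_half mulrN -[X in y ^ X - _]opprK.
by apply: (qint_neq0 y0 y_nroot (k := - (n%:Z * j))); rewrite oppr_eq0 mulf_neq0 //; lia.
Qed.

(* The E_{0,l}, E_{1,l} and E_{-1,l} generate all the E_{k,l}. *)
Lemma action_unique (rho : diffq C -> V -> V) :
    is_diffq_action qpow rho ->
    (forall l v, l != 0 -> rho (dE C 0 l) v = twisted_op 0 l v) ->
    (forall l v, rho (dE C 1 l) v = twisted_op 1 l v) ->
    (forall l v, rho (dE C (- 1) l) v = twisted_op (- 1) l v) ->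
  forall k l v, (k, l) != (0, 0) -> rho (dE C k l) v = twisted_op k l v.
Proof.
move=> [rhoL rhoV rhoB] rho_0 rho_1 rho_N1.
have step (e k l : int) : e != 0 -> k != 0 -> k + e != 0 ->
    (forall l v, rho (dE C e l) v = twisted_op e l v) ->
    (forall l v, rho (dE C k l) v = twisted_op k l v) ->
    forall v, rho (dE C (k + e) l) v = twisted_op (k + e) l v.
  move=> e0 k0 ke rho_e rho_k v.
  (* [s] makes the structure constant nonzero: the exponent is [- l e] if [l != 0], and [- (k + e)]
     if [l = 0]. *)
  pose s := if l == 0 then 1 else l.
  have se : (l - s) * k - s * e != 0.
    rewrite /s; have [->|l0] := eqVneq l 0; last first.
      by rewrite subrr mul0r sub0r oppr_eq0 mulf_neq0.
    by rewrite sub0r mulN1r mul1r -opprD oppr_eq0.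
  have ks : (k, s) != (0, 0) by rewrite xpair_eqE (negPf k0).
  have es : (e, l - s) != (0, 0) by rewrite xpair_eqE (negPf e0).
  have := rhoB (dE C k s) (dE C e (l - s)) v.
  rewrite bracketE // !rho_k !rho_e twisted_op_bracket.
  have -> : (k == - e) = false by rewrite -addr_eq0 (negPf ke).
  rewrite (negPf ke) /= !scale0r !addr0 (linZ (rhoL v)).
  have -> : s + (l - s) = l by rewrite addrC subrK.
  have -> : s * e - (l - s) * k = - ((l - s) * k - s * e) by rewrite opprB.
  by apply: scalerI; apply: qpow_half_sub_neq0.
have pos (m : nat) l v : rho (dE C m.+1 l) v = twisted_op m.+1 l v.
  elim: m l v => [//|m IHm] l v.
  have -> : m.+2%:Z = m.+1%:Z + 1 by lia.
  by apply: step => //; lia.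
have neg (m : nat) l v : rho (dE C (- m.+1%:Z) l) v = twisted_op (- m.+1%:Z) l v.
  elim: m l v => [//|m IHm] l v.
  have -> : - m.+2%:Z = - m.+1%:Z + - 1 by lia.
  by apply: step => //; lia.
case=> [[|m]|m] l v kl; last by rewrite NegzE neg.
  by apply: rho_0; apply: contra kl => /eqP ->.
exact: pos.
Qed.

Lemma qpow_inv : qpow (1 / n%:R) = y ^ 2.
Proof.
rewrite -(qpow_int q0 qpowP); congr qpow; rewrite natrM.
have nn : n%:R != 0 :> rat by rewrite pnatr_eq0 -lt0n.
by field.
Qed.

Lemma fock_op1 N v : fock_op a y ur 1 N v =
  (ur / (1 - qpow (1 / n%:R))) *: vertex a (Ecoef qpow n) N v.
Proof.
rewrite /fock_op /= mulr1 expr1z qpow_inv; congr (_ *: vertex a _ N v).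
by apply/funext => j; rewrite mul1r (Ecoef_qint q0 qpowP).
Qed.

Lemma fock_opN1 N v : fock_op a y ur (- 1) N v =
  (ur^-1 / (1 - qpow (- (1 / n%:R)))) *: vertex a (Fcoef qpow n) N v.
Proof.
rewrite /fock_op /= mulrN1 (qpowN q0 qpowP) qpow_inv invr_expz.
rewrite -[ur ^ (- 1)]invr_expz expr1z; congr (_ *: vertex a _ N v).
by apply/funext => j; rewrite mulN1r (Fcoef_qint q0 qpowP).
Qed.

End FockAction.

Section FockModule.
Variables (C : numFieldType) (q : C) (qpow : rat -> C).
Hypotheses (q0 : q != 0) (qpowP : fractional_powers q qpow).
Hypothesis q_nroot : not_root_of_unity q.
Variables (V : lmodType C) (a : int -> V -> V) (alpha : C) (vac : V).
Hypothesis fockV : is_heisenberg_fock a alpha vac.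
Variables (u : C) (rho : diffq C -> V -> V).
Hypotheses (u0 : u != 0) (rhoP : is_fock_module q qpow a u rho).

Lemma fock_moduleE k l v : (k, l) != (0, 0) ->
  rho (dE C k l) v = twisted_op qpow a 1 0 u k l v.
Proof.
case: rhoP => rho_action _ rho_H rho_E rho_F.
have q1 : qpow (1 / 1%:R) = q by rewrite divr1 (proj1 qpowP).
have N1 k' l' : 1%N%:Z * l' + 0 * k' = l' by rewrite mul0r addr0 mul1r.
apply: (action_unique q0 qpowP q_nroot fockV (isT : (0 < 1)%N) u0 rho_action).
- by move=> {}l {}v l0; rewrite rho_H // /twisted_op N1 fock_op0.
- move=> {}l {}v; rewrite rho_E /twisted_op N1 (fock_op1 q0 qpowP a u (isT : (0 < 1)%N)) q1.
  (* The reversal of sign in the index is harmless because [Ecoef] is even. *)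
  have -> // : (fun j => Ecoef qpow 1 (- j)) = Ecoef qpow 1.
  by apply/funext => j; rewrite !(Ecoef_qint q0 qpowP) // qintN mulrNz invrN mulrNN.
- move=> {}l {}v; rewrite rho_F /twisted_op N1 (fock_opN1 q0 qpowP a u (isT : (0 < 1)%N)).
  rewrite (qpowN q0 qpowP) q1.
  have -> // : (fun j => Fcoef qpow 1 (- j)) = Fcoef qpow 1.
  apply/funext => j; rewrite !(Fcoef_qint q0 qpowP) // opprK qintN.
  by rewrite mulrNz invrN mulrN mulNr.
Qed.

End FockModule.

(** * Averaging over the roots of unity *)

Section TwistedFields.
Variables (R : realType) (q : R[i]) (qpow : rat -> R[i]).
Variables (V : lmodType R[i]) (a : int -> V -> V) (alpha : R[i]) (vac : V).
Hypothesis fockV : is_heisenberg_fock a alpha vac.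
Variables (n : nat) (n' : int) (ur : R[i]).
Hypothesis n_gt0 : (0 < n)%N.

Let zeta0 : zeta R n != 0.
Proof.
by apply: contra_eq_neq (zeta_root R n_gt0) => ->; rewrite expr0n gtn_eqF // eq_sym oner_eq0.
Qed.

(* Only the exponents of [w] congruent to [s] modulo [n] survive the sum over
   the [n]-th roots of unity. *)
Lemma zeta_average (f : int -> R[i]) (s k : int) v :
  \sum_(l < n) zeta R n ^ (l%:Z * s) *:
    zcoef n s (vertex a (fun j => f j * zeta R n ^ (- (j * l%:Z)))) k v =
  n%:R *: vertex a f (n%:Z * k + s) v.
Proof.
have E (l : 'I_n) : zeta R n ^ (l%:Z * s) *:
    zcoef n s (vertex a (fun j => f j * zeta R n ^ (- (j * l%:Z)))) k v =
    vertex a f (n%:Z * k + s) v.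
  rewrite /zcoef.
  have -> : (fun j => f j * zeta R n ^ (- (j * l%:Z))) =
      (fun j => f j * (zeta R n ^ l%:Z) ^ (- j)).
    by apply/funext => j; rewrite exprz_exp mulrN mulrC [j * _]mulrC mulrC.
  rewrite (vertex_rescale fockV) ?expfz_neq0 // scalerA exprz_exp -expfzDr //.
  (* The total exponent is a multiple of $n$, so the root of unity drops out and all summands are
     equal. *)
  have -> : l%:Z * s + l%:Z * - (n%:Z * k + s) = n%:Z * (- (l%:Z * k)) by ring.
  by rewrite -exprz_exp -exprnP zeta_root // exp1rz scale1r.
by under eq_bigr do rewrite E; rewrite sumr_const card_ord scaler_nat.
Qed.

Lemma EtwE k v : Etw qpow a n n' ur k v =
  (ur / (1 - qpow (1 / n%:R))) *: vertex a (Ecoef qpow n) (n%:Z * k + n') v.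
Proof.
rewrite /Etw zeta_average scalerA; congr (_ *: _).
by rewrite invfM mulrA mulrAC mulfVK // pnatr_eq0 -lt0n.
Qed.

Lemma FtwE k v : Ftw qpow a n n' ur k v =
  (ur^-1 / (1 - qpow (- (1 / n%:R)))) *: vertex a (Fcoef qpow n) (n%:Z * k - n') v.
Proof.
rewrite /Ftw; under eq_bigr do rewrite -mulrN.
rewrite zeta_average scalerA; congr (_ *: _).
by rewrite invfM mulrA mulrAC mulfVK // pnatr_eq0 -lt0n.
Qed.

End TwistedFields.

(** * Comparison with the module twisted by $\sigma$ *)

Section Isomorphism.
Variables (C : numFieldType) (q : C) (qpow : rat -> C).
Hypotheses (q0 : q != 0) (qpowP : fractional_powers q qpow).
Hypothesis q_nroot : not_root_of_unity q.
Variables (V : lmodType C) (a : int -> V -> V) (alpha : C) (vac : V).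
Hypothesis fockV : is_heisenberg_fock a alpha vac.
Variables (m' m n' : int) (n : nat) (u ur : C).
Hypotheses (n_gt0 : (0 < n)%N) (ur0 : ur != 0) (urP : ur ^+ n = u).
Hypothesis det1 : m' * n%:Z - m * n' = 1.

Let u0 : u != 0. Proof. by rewrite -urP expf_neq0. Qed.

Let A (p : int * int) := twisted_op qpow a n n' ur p.1 p.2.
Let B (p : int * int) :=
  twisted_op qpow a 1 0 u (m' * p.1 + m * p.2) (n' * p.1 + n%:Z * p.2).
Let deg (p : int * int) := n%:Z * p.2 + n' * p.1.

Let y := qpow (1 / (2 * n)%:R).
Let y1 := qpow (1 / (2 * 1)%:R).

Let y1E : y1 = y ^+ n.
Proof.
rewrite exprnP -(qpow_int q0 qpowP); congr qpow; rewrite natrM.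
have nn : n%:R != 0 :> rat by rewrite pnatr_eq0 -lt0n.
by field.
Qed.

Let y0 : y != 0 := qpow_neq0 q0 qpowP _.
Let n2_gt0 : (0 < 2 * n)%N. Proof. by rewrite muln_gt0. Qed.
Let y_nroot k : k != 0 -> y ^ k != 1 := qpow_nroot q0 qpowP q_nroot n2_gt0.

Let BE p v : B p v = fock_op a y1 u (m' * p.1 + m * p.2) (deg p) v.
Proof.
by rewrite /B /twisted_op [1%N%:Z * _]mul1r mul0r addr0 /deg [n' * _ + _]addrC.
Qed.

Lemma sigma_inj k l : (m' * k + m * l == 0) && (n' * k + n%:Z * l == 0) =
  (k == 0) && (l == 0).
Proof.
apply/andP/andP => [[/eqP E1 /eqP E2]|[/eqP-> /eqP->]]; last by rewrite !mulr0 addr0.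
have kE : k = n%:Z * (m' * k + m * l) - m * (n' * k + n%:Z * l).
  by rewrite -[LHS]mul1r -det1; ring.
have lE : l = m' * (n' * k + n%:Z * l) - n' * (m' * k + m * l).
  by rewrite -[LHS]mul1r -det1; ring.
by rewrite E1 E2 !mulr0 subrr in kE lE; rewrite kE lE.
Qed.

(** Determinant 1 makes sigma preserve $sk-lr$, so both families have the same structure constants;
    the levels of [B] become [n] and [n'] as well. *)
Let AB_bracket i j : exists c d k,
  (forall v, A i (A j v) = A j (A i v) + (c *: A k v + d *: v)) /\
  (forall v, B i (B j v) = B j (B i v) + (c *: B k v + d *: v)).
Proof.
case: i j => [k l] [r s].
exists (qpow ((s * k - l * r)%:~R / 2) - qpow ((l * r - s * k)%:~R / 2)).
exists (if (k + r == 0) && (l + s == 0) then n'%:~R * k%:~R + n%:R * l%:~R else 0).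
exists (k + r, l + s); split=> v.
  by rewrite -(twisted_op_bracket q0 qpowP q_nroot fockV) // addrC subrK.
have H := twisted_op_bracket q0 qpowP q_nroot fockV 0 (isT : (0 < 1)%N) u0
  (m' * k + m * l) (n' * k + n%:Z * l) (m' * r + m * s) (n' * r + n%:Z * s) v.
have E : forall k l r s : int,
    (n' * r + n%:Z * s) * (m' * k + m * l) - (n' * k + n%:Z * l) * (m' * r + m * s)
    = s * k - l * r.
  by move=> *; rewrite -[RHS]mul1r -det1; ring.
have E1 : m' * k + m * l + (m' * r + m * s) = m' * (k + r) + m * (l + s) by ring.
have E2 : n' * k + n%:Z * l + (n' * r + n%:Z * s) = n' * (k + r) + n%:Z * (l + s).
  by ring.
have EN : (n' * k + n%:Z * l) * (m' * r + m * s) -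
    (n' * r + n%:Z * s) * (m' * k + m * l) = l * r - s * k.
  by rewrite -[LHS]opprB E opprB.
have EI : (n' * k + n%:Z * l)%:~R = n'%:~R * k%:~R + n%:R * l%:~R :> C.
  by rewrite intrD !intrM.
rewrite E EN E1 E2 sigma_inj mul0r add0r mul1r EI in H.
by rewrite /B /= -H [RHS]addrC subrK.
Qed.

(** In degree 0 the first index is [k = n j] with [j = m' k + m l], and both operators act on [vac]
    by $u^j/(1-q^j)$, or by [alpha] if [j = 0]. *)
Let AB_vac p : 0 <= deg p -> exists e, A p vac = e *: vac /\ B p vac = e *: vac.
Proof.
case: p => k l; rewrite BE /A /twisted_op -/(deg (k, l)) /= => d0.
have fock_op_vac_gt0 z w i d : 0 < d -> fock_op a z w i d vac = 0.
  move=> d1; have [->|i0] := eqVneq i 0; first by rewrite fock_op0 (fock_vac_gt0 fockV).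
  by rewrite (fock_op_vac fockV) ?ltW // gt_eqF // scale0r.
move: d0; rewrite le0r => /orP[/eqP dE|d0]; last first.
  by exists 0; rewrite scale0r !fock_op_vac_gt0.
have kE : k = n%:Z * (m' * k + m * l).
  have -> : n%:Z * (m' * k + m * l) = (m' * n%:Z - m * n') * k + m * deg (k, l).
    by rewrite /deg /=; ring.
  by rewrite dE det1 mulr0 addr0 mul1r.
rewrite dE; move: (m' * k + m * l) kE => j ->.
have [->|j0] := eqVneq j 0.
  by exists alpha; rewrite mulr0 !fock_op0 (fock_vac0 fockV).
have nj0 : n%:Z * j != 0 by rewrite mulf_neq0 //; lia.
rewrite !(fock_op_vac fockV) // eqxx; eexists; split=> //; congr (_ *: _).
rewrite y1E -urP (exprnP y n) (exprnP ur n) !exprz_exp.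
by congr (_ / (1 - y ^ _)); ring.
Qed.

Let A_irr : irreducible_family a A.
Proof.
move=> K K0 KL KA l v l0 Kv.
(* The solutions of $nl'+n'k=l$ used here are $k=n(e+t)-lm$, $l'=lm'-n'(e+t)$; [e] is large enough
   to make $k_0$ positive. *)
pose e := (absz (l * m)%R).+1; pose k0 := absz (n%:Z * e%:Z - l * m)%R.
have le_e : l * m < n%:Z * e%:Z.
  have : l * m < e%:Z by rewrite /e; lia.
  by move=> /lt_le_trans; apply; rewrite ler_peMl //; lia.
have k0E : k0%:Z = n%:Z * e%:Z - l * m by rewrite /k0; lia.
have k0_gt0 : (0 < k0)%N by lia.
apply: (fock_op_progression_closed fockV y0 ur0 y_nroot K0 KL k0_gt0 n_gt0 l0) => t.
have := KA ((k0 + n * t)%N%:Z, l * m' - n' * (e%:Z + t%:Z)) v Kv.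
rewrite /A /twisted_op /=.
have -> // : n%:Z * (l * m' - n' * (e%:Z + t%:Z)) + n' * (k0 + n * t)%N = l.
by rewrite PoszD PoszM k0E -[RHS]mulr1 -det1; ring.
Qed.

(** [(- m l, m' l)] is the preimage of [(0, l)] under sigma, so the modes themselves belong to the
    family [B]. *)
Let B_irr : irreducible_family a B.
Proof.
move=> K K0 KL KB l v l0 Kv; have := KB (- m * l, m' * l) v Kv.
rewrite BE /deg /=; have -> : m' * (- m * l) + m * (m' * l) = 0 by ring.
have -> : n%:Z * (m' * l) + n' * (- m * l) = l.
  by rewrite -[RHS]mul1r -det1; ring.
by rewrite fock_op0.
Qed.

Lemma twisted_isomorphism : exists f : V -> V,
  [/\ linear f, bijective f & forall k l v,
    f (twisted_op qpow a n n' ur k l v) =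
    twisted_op qpow a 1 0 u (m' * k + m * l) (n' * k + n%:Z * l) (f v)].
Proof.
have [f [fL fB fE]] : exists f : V -> V,
    [/\ linear f, bijective f & forall p v, f (A p v) = B p (f v)].
  apply: (hw_isomorphism (fockV := fockV) (deg := deg)) => //.
  - by move=> p; apply: (fock_op_linear fockV).
  - by move=> p; apply: (fock_op_linear fockV).
  - by move=> p v p0; apply: vev_fock_op_lt0.
  - by move=> p v p0; rewrite BE vev_fock_op_lt0.
by exists f; split=> // k l v; apply: (fE (k, l)).
Qed.

End Isomorphism.

(** * Existence of the twisted module and its isomorphism with $\mathcal F_u^\sigma$ *)

Unset Implicit Arguments.
Set Strict Implicit.
Set Printing Implicit Defensive.

Theorem theorem4p4 (R : realType)
    (q : R[i]) (q_neq0 : q != 0) (q_nroot : not_root_of_unity q)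
    (qpow : rat -> R[i]) (qpowP : fractional_powers q qpow)
    (sigma : 'M[int]_2) (det_sigma : \det sigma = 1)
    (n : nat) (n_gt0 : (0 < n)%N) (sigma11 : sigma 1 1 = n%:Z)
    (u : R[i]) (u_neq0 : u != 0) (ur : R[i]) (urP : ur ^+ n = u)
    (V : lmodType R[i]) (a : int -> V -> V) (alpha : R[i]) (vac : V)
    (fockV : is_heisenberg_fock a alpha vac) :
  exists rho : diffq R[i] -> V -> V,
    is_twisted_module qpow a n (sigma 1 0) ur rho /\
    forall rho_u : diffq R[i] -> V -> V,
      is_fock_module q qpow a u rho_u ->
      isomorphic rho (twist sigma rho_u).
Proof.
have ur0 : ur != 0.
  by apply: contra u_neq0 => /eqP E; rewrite -urP E expr0n gtn_eqF.
have det1 : sigma 0 0 * n%:Z - sigma 0 1 * sigma 1 0 = 1.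
  rewrite -sigma11 -det_sigma (expand_det_row _ 0) !big_ord_recl big_ord0 addr0.
  rewrite /cofactor !det_mx11 !mxE /= expr0 expr1 mul1r mulN1r mulrN.
  by congr (sigma _ _ * sigma _ _ - sigma _ _ * sigma _ _); apply/val_inj.
exists (twisted_action qpow a n (sigma 1 0) ur); split.
  split.
  - exact: (twisted_action_is_action q_neq0 qpowP q_nroot fockV).
  - by split=> v; rewrite /twisted_action fglift_basis.
  - move=> k v k0; rewrite twisted_action_dE; last first.
      by rewrite xpair_eqE negb_and k0 orbT.
    by rewrite /twisted_op fock_op0 mulr0 addr0.
  - move=> k v; rewrite twisted_action_dE; last by rewrite xpair_eqE.
    rewrite /twisted_op [sigma 1 0 * 1]mulr1.
    rewrite (fock_op1 q_neq0 qpowP a ur n_gt0).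
    rewrite (EtwE qpow fockV (sigma 1 0) ur n_gt0 k v).
    by [].
  - move=> k v; rewrite twisted_action_dE; last by rewrite xpair_eqE.
    rewrite /twisted_op [sigma 1 0 * -1]mulrN1.
    rewrite (fock_opN1 q_neq0 qpowP a ur n_gt0).
    by rewrite (FtwE qpow fockV (sigma 1 0) ur n_gt0 k v).
move=> rho_u rho_uP.
have [f [fL fB fE]] :=
  twisted_isomorphism q_neq0 qpowP q_nroot fockV n_gt0 ur0 urP det1.
have rho_uE := fock_moduleE q_neq0 qpowP q_nroot fockV u_neq0 rho_uP.
have [[rhoL rhoV _] [rho_c rho_c'] _ _ _] := rho_uP.
exists f; split=> // x v; rewrite /twist.
have tL := @fglift_linear _ V (fun i => twisted_index qpow a n (sigma 1 0) ur i v).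
elim/diffq_ind: x => [c x z Ex Ez|k l kl||].
- rewrite sigma_aut_linear (rhoL (f v)) -Ex -Ez -fL; congr f; exact: tL.
- rewrite twisted_action_dE // fE sigma_aut_dE // rho_uE ?sigma11 //.
  move: kl; rewrite !xpair_eqE.
  by rewrite (sigma_inj det1).
(* On $\mathcal F_u$, where [c] acts by 1 and [c'] by 0, the image $mc'+nc$ of [c] acts by $n$. *)
- rewrite /twisted_action /sigma_aut !fglift_basis /= sigma11 (rhoL (f v)).
  by rewrite (linZ (rhoL (f v))) rho_c rho_c' scaler0 add0r (linZ fL).
- rewrite /twisted_action /sigma_aut !fglift_basis /= (rhoL (f v)).
  by rewrite (linZ (rhoL (f v))) rho_c rho_c' scaler0 add0r (linZ fL).
Qed.
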